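(* Assume $\operatorname{char}\mathbb{K}=0$. Then $\{\mathcal{F}_n^{\mathrm{FdB}}\}_{n=0}^{\infty}$ is the coradical filtration of $\mathcal{H}_{\mathrm{FdB}}^{cop}$ (and of $\mathcal{H}_{\mathrm{FdB}}$).
   Context: $\mathbb{K}$ is a field. The Faà di Bruno Hopf algebra $\mathcal{H}_{\mathrm{FdB}}$ is the algebra $\mathbb{K}[u_1^{\pm1},u_2,u_3,\ldots]$ with $\epsilon(u_n)=\delta_{n,1}$, $\Delta(u_1^{-1})=u_1^{-1}\otimes u_1^{-1}$ and $\Delta(u_n)=\sum_{k=1}^nu_k\otimes B_{n,k}(u_1,\ldots,u_n)$, where $$B_{n,k}(u_1,\ldots,u_n)=\sum_{\substack{k_1+k_2+\cdots+k_n=k\\ k_1+2k_2+\cdots+nk_n=n}}\frac{n!}{k_1!k_2!\cdots k_n!}\Big(\frac{u_1}{1!}\Big)^{k_1}\Big(\frac{u_2}{2!}\Big)^{k_2}\cdots\Big(\frac{u_n}{n!}\Big)^{k_n}$$ is the partial Bell polynomial. $\mathcal{H}_{\mathrm{FdB}}^{cop}$ is the same algebra with the opposite coproduct. Put $x=u_1$, $x_m=u_{m+1}u_1^{-1}$ for $m\ge 1$, and $z_n=x_n-\frac{(n+1)!}{2^n}x_1^n$ for $n\ge 2$. For $n\ge 0$ let $\mathcal{F}_n^{\mathrm{FdB}}=F_n^{\mathrm{FdB}}\,\mathbb{K}[x^{\pm1}]$, where $F_n^{\mathrm{FdB}}$ is the span of all monomials $z_{i_m}^{s_m}\cdots z_{i_2}^{s_2}x_1^{s_1}$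 with $i_m>\cdots>i_2\ge 2$, nonnegative exponents, and $(i_m-1)s_m+\cdots+(i_2-1)s_2+s_1\le n$. The coradical filtration of a coalgebra $C$ is given by $C_0=$ the coradical of $C$ (sum of simple subcoalgebras) and $C_n=\Delta^{-1}(C_{n-1}\otimes C+C\otimes C_0)$ for $n\ge 1$. *)

(* Defs.v *)
From HB Require Import structures.
From mathcomp Require Import all_boot all_order all_algebra.
From mathcomp Require Import finmap.
From mathcomp Require Import xfinmap monalg.

Set Implicit Arguments.
Unset Strict Implicit.
Unset Printing Implicit Defensive.

Import GRing.Theory.

Local Open Scope ring_scope.

(* Linear algebra over a field, in possibly infinite dimension.        *)
(* Subspaces are Prop-valued predicates; [{malg K[I]}] is the vector   *)
(* space with basis [basis K i], [i : I].                               *)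

(* locked, to keep unification from unfolding finite-support functions *)
HB.lock Definition basis (K : fieldType) (I : choiceType) (i : I) :
  {malg K[I]} := << i >>.

Section LinearAlgebra.
Variable K : fieldType.

Definition subspace (V : lmodType K) (D : V -> Prop) : Prop :=
  D 0 /\ forall (a : K) (v w : V), D v -> D w -> D (a *: v + w).

Definition span (V : lmodType K) (S : V -> Prop) (v : V) : Prop :=
  exists (n : nat) (c : 'I_n -> K) (w : 'I_n -> V),
    (forall i, S (w i)) /\ v = \sum_(i < n) c i *: w i.

Definition sum_subspace (V : lmodType K) (D E : V -> Prop) (v : V) : Prop :=
  exists d e : V, [/\ D d, E e & v = d + e].

Definition linext (I : choiceType) (V : lmodType K) (h : I -> V)
    (f : {malg K[I]}) : V :=
  \sum_(i <- msupp f) f@_i *: h i.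

Section Linext.
Variables (I : choiceType) (V : lmodType K).
Implicit Types (h : I -> V) (f : {malg K[I]}).

Lemma linextEw h f (d : {fset I}) :
  (msupp f `<=` d)%fset -> linext h f = \sum_(i <- d) f@_i *: h i.
Proof.
move=> le; rewrite /linext (big_fset_incl _ le) //.
by move=> i _ /mcoeff_outdom ->; rewrite scale0r.
Qed.

Lemma linext_is_linear h : linear (linext h).
Proof.
move=> a f g; pose d := (msupp f `|` msupp g)%fset.
have le1 : (msupp (a *: f + g) `<=` d)%fset.
  apply: (fsubset_trans (msuppD_le _ _)).
  exact: (fsetSU _ (msuppZ_le _ _)).
rewrite (linextEw h le1) (linextEw h (fsubsetUl (msupp f) (msupp g))).
rewrite (linextEw h (fsubsetUr (msupp f) (msupp g))).
rewrite scaler_sumr -big_split /=; apply: eq_bigr => i _.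
by rewrite mcoeffD mcoeffZ scalerDl scalerA.
Qed.

HB.instance Definition _ h :=
  GRing.isLinear.Build K {malg K[I]} V *:%R (linext h) (linext_is_linear h).

Lemma linextU h (c : K) i : linext h << c *g i >> = c *: h i.
Proof.
by rewrite (linextEw h msuppU_le) big_seq_fset1 mcoeffUU.
Qed.

Lemma linext_basis h i : linext h (basis K i) = h i.
Proof. by rewrite basis.unlock linextU scale1r. Qed.

Lemma linext_eq h h' : h =1 h' -> linext h =1 linext h'.
Proof. by move=> eh f; apply: eq_bigr => i _; rewrite eh. Qed.

Lemma linext_comp (W : lmodType K) (L : {linear V -> W}) h f :
  L (linext h f) = linext (L \o h) f.
Proof. by rewrite linear_sum; apply: eq_bigr => i _; rewrite linearZ. Qed.

Lemma linextD h h' f :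
  linext (fun i => h i + h' i) f = linext h f + linext h' f.
Proof. by rewrite -big_split; apply: eq_bigr => i _; rewrite scalerDr. Qed.

Lemma linextZ h (a : K) f : linext (fun i => a *: h i) f = a *: linext h f.
Proof.
rewrite scaler_sumr; apply: eq_bigr => i _.
by rewrite !scalerA mulrC.
Qed.

End Linext.

Lemma linext_id (I : choiceType) (f : {malg K[I]}) :
  linext (@basis K I) f = f.
Proof.
rewrite basis.unlock.
rewrite [RHS]monalgE; apply: eq_bigr => i _.
by apply/malgP => j; rewrite mcoeffZ !mcoeffU mulr_natr.
Qed.

Lemma linext_exchange (I J : choiceType) (V : lmodType K) (h : I -> J -> V)
    (f : {malg K[I]}) (g : {malg K[J]}) :
  linext (fun i => linext (h i) g) f
    = linext (fun j => linext (fun i => h i j) f) g.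
Proof.
rewrite /linext; under eq_bigr => i _ do rewrite scaler_sumr.
rewrite exchange_big /=; apply: eq_bigr => j _.
rewrite scaler_sumr; apply: eq_bigr => i _.
by rewrite !scalerA mulrC.
Qed.

(* The tensor product of the spaces with bases I and J is the space with *)
(* basis I * J.                                                          *)
Definition tens (I J : choiceType) (f : {malg K[I]}) (g : {malg K[J]}) :
    {malg K[(I * J)%type]} :=
  linext (fun i => linext (fun j => basis K (i, j)) g) f.

Lemma tensUU (I J : choiceType) (i : I) (j : J) :
  tens (basis K i) (basis K j) = basis K (i, j) :> {malg K[(I*J)%type]}.
Proof. by rewrite /tens linext_basis linext_basis. Qed.

Lemma tens_linl (I J : choiceType) (g : {malg K[J]}) :
  linear (fun f : {malg K[I]} => tens f g).
Proof. by move=> a f f'; rewrite /tens linearP. Qed.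

Lemma tens_linr (I J : choiceType) (f : {malg K[I]}) :
  linear (fun g : {malg K[J]} => tens f g).
Proof. by move=> a g g'; rewrite /tens !(linext_exchange _ f) linearP. Qed.

Definition tens_swap (I J : choiceType) (t : {malg K[(I * J)%type]}) :
    {malg K[(J * I)%type]} :=
  linext (fun p => basis K (p.2, p.1)) t.

HB.instance Definition _ I J := GRing.Linear.copy (@tens_swap I J)
  (linext (fun p => basis K (p.2, p.1))).

Definition tens_subspace (I J : choiceType)
    (D : {malg K[I]} -> Prop) (E : {malg K[J]} -> Prop) :
    {malg K[(I * J)%type]} -> Prop :=
  span (fun t => exists f g, [/\ D f, E g & t = tens f g]).

End LinearAlgebra.

(* The coalgebra axioms are not bundled: subcoalgebras, the coradical  *)
(* and its filtration are expressed with the structure maps only.      *)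

Record coalgebra_data (K : fieldType) (I : choiceType) := CoalgebraData {
  comul : {linear {malg K[I]} -> {malg K[(I * I)%type]}};
  counit : {linear {malg K[I]} -> K^o}
}.

Section Coradical.
Variables (K : fieldType) (I : choiceType) (C : coalgebra_data K I).
Notation V := {malg K[I]}.

Definition cop : coalgebra_data K I :=
  CoalgebraData (@tens_swap K I I \o comul C) (counit C).

Definition subcoalgebra (D : V -> Prop) : Prop :=
  subspace D /\ forall h, D h -> tens_subspace D D (comul C h).

Definition simple_subcoalgebra (D : V -> Prop) : Prop :=
  [/\ subcoalgebra D,
      exists2 h, D h & h != 0
    & forall E : V -> Prop, subcoalgebra E -> (forall h, E h -> D h) ->
        (forall h, E h -> h = 0) \/ (forall h, D h -> E h)].

Definition coradical : V -> Prop :=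
  span (fun h => exists2 D, simple_subcoalgebra D & D h).

Fixpoint coradical_filtration (n : nat) : V -> Prop :=
  if n is m.+1 then fun h =>
    sum_subspace (tens_subspace (coradical_filtration m) (fun _ => True))
                 (tens_subspace (fun _ => True) coradical)
                 (comul C h)
  else coradical.

Definition is_coradical_filtration (F : nat -> V -> Prop) : Prop :=
  forall n h, F n h <-> coradical_filtration n h.

End Coradical.

(* [monoid_algebra K M] is the monoid algebra K[M] of a commutative    *)
(* monoid M written additively: basis vectors multiply by adding their *)
(* indices.                                                            *)
(* The ring structure of monalg does not apply to Laurent monomials,   *)
(* since its [monomType] forbids nontrivial invertible elements.       *)

Definition monoid_algebra (K : fieldType) (M : nmodType) := {malg K[M]}.

Section MonoidAlgebra.
Variables (K : fieldType) (M : nmodType).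
Notation A := (monoid_algebra K M).

HB.instance Definition _ := GRing.Lmodule.copy A {malg K[M]}.

Definition ma_one : A := basis K 0.

Definition ma_mul (f g : A) : A :=
  linext (fun p => linext (fun q => basis K (p + q)) g) f.

Lemma ma_mulUl p (g : A) :
  ma_mul (basis K p) g = linext (fun q => basis K (p + q)) g.
Proof. by rewrite /ma_mul linext_basis. Qed.

Lemma ma_mulUU p q : ma_mul (basis K p) (basis K q) = basis K (p + q).
Proof. by rewrite ma_mulUl linext_basis. Qed.

Lemma ma_mulC : commutative ma_mul.
Proof.
move=> f g; rewrite /ma_mul linext_exchange.
apply: linext_eq => q; apply: linext_eq => p; by rewrite addrC.
Qed.

Lemma ma_mul_linearl g : linear (ma_mul^~ g).
Proof. by move=> a f f'; rewrite /ma_mul linearP. Qed.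

Lemma ma_mul_linearr f : linear (ma_mul f).
Proof. by move=> a g g'; rewrite ma_mulC ma_mul_linearl !(ma_mulC _ f). Qed.

Lemma ma_mulDl : left_distributive ma_mul +%R.
Proof.
by move=> f f' g; have := ma_mul_linearl g 1 f f'; rewrite !scale1r.
Qed.

Lemma ma_mul1 : left_id ma_one ma_mul.
Proof.
move=> g; rewrite ma_mulUl -[RHS]linext_id.
by apply: linext_eq => q; rewrite add0r.
Qed.

Lemma linear_ext (V : lmodType K) (L L' : A -> V) :
  linear L -> linear L' -> (forall p : M, L (basis K p) = L' (basis K p)) ->
  L =1 L'.
Proof.
move=> lL lL' eL f.
pose P := HB.pack_for {linear A -> V} L (GRing.isLinear.Build K A V *:%R L lL).
pose P' := HB.pack_for {linear A -> V} L'
  (GRing.isLinear.Build K A V *:%R L' lL').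
rewrite -[f]linext_id -[LHS]/(P _) -[RHS]/(P' _) !linext_comp.
exact: linext_eq.
Qed.

Lemma ma_mulA : associative ma_mul.
Proof.
move=> f g h; move: f; apply: linear_ext => [a f f'|a f f'|p].
- exact: ma_mul_linearl.
- by rewrite !ma_mul_linearl.
move: g; apply: linear_ext => [a g g'|a g g'|q].
- by rewrite ma_mul_linearl ma_mul_linearr.
- by rewrite ma_mul_linearr ma_mul_linearl.
move: h; apply: linear_ext => [a h h'|a h h'|r].
- by rewrite !ma_mul_linearr.
- by rewrite ma_mul_linearr.
by rewrite !ma_mulUU addrA.
Qed.

Lemma ma_one_neq0 : ma_one != 0.
Proof.
by rewrite /ma_one basis.unlock (monalgU_eq0 (1 : K) (0 : M)) oner_eq0.
Qed.

HB.instance Definition _ := GRing.Zmodule_isComNzRing.Build A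
  ma_mulA ma_mulC ma_mul1 ma_mulDl ma_one_neq0.

Lemma ma_scaleAl (c : K) (f g : A) : c *: (f * g) = (c *: f) * g.
Proof. by rewrite -[RHS]/(ma_mul (c *: f) g) /ma_mul linearZ. Qed.

HB.instance Definition _ := GRing.Lmodule_isLalgebra.Build K A ma_scaleAl.
HB.instance Definition _ := GRing.Lalgebra_isComAlgebra.Build K A.

End MonoidAlgebra.

Lemma ma_basisM (K : fieldType) (M : nmodType) (p q : M) :
  (basis K p : monoid_algebra K M) * (basis K q) = (basis K (p + q)).
Proof. exact: ma_mulUU. Qed.

Lemma linear_extM (K : fieldType) (M : nmodType) (A : comAlgType K)
    (L : monoid_algebra K M -> A) :
  linear L ->
  (forall p q : M, L (basis K (p + q)) = L (basis K p) * L (basis K q)) ->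
  {morph L : f g / f * g}.
Proof.
move=> lL H f g; move: f; apply: linear_ext => [a f f'|a f f'|p].
- by rewrite mulrDl -scalerAl lL.
- by rewrite lL mulrDl scalerAl.
move: g; apply: linear_ext => [a f f'|a f f'|q].
- by rewrite mulrDr -scalerAr lL.
- by rewrite lL mulrDr scalerAr.
by rewrite ma_basisM H.
Qed.

Lemma tensM (K : fieldType) (M N : nmodType) (f f' : monoid_algebra K M)
    (g g' : monoid_algebra K N) :
  (tens (f * f') (g * g') : monoid_algebra K (M * N)%type) =
  (tens f g : monoid_algebra K (M * N)%type) * tens f' g'.
Proof.
move: f; apply: linear_ext => [a f1 f2|a f1 f2|p].
- by rewrite mulrDl -scalerAl tens_linl.
- by rewrite tens_linl mulrDl scalerAl.
move: f'; apply: linear_ext => [a f1 f2|a f1 f2|p'].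
- by rewrite mulrDr -scalerAr tens_linl.
- by rewrite tens_linl mulrDr scalerAr.
move: g; apply: linear_ext => [a f1 f2|a f1 f2|q].
- by rewrite mulrDl -scalerAl tens_linr.
- by rewrite tens_linr mulrDl scalerAl.
move: g'; apply: linear_ext => [a f1 f2|a f1 f2|q'].
- by rewrite mulrDr -scalerAr tens_linr.
- by rewrite tens_linr mulrDr scalerAr.
by rewrite !ma_basisM !tensUU ma_basisM.
Qed.

HB.instance Definition _ (I : choiceType) := GRing.isNmodule.Build {cmonom I}
  (@mulcmA I) (@mulcmC I) (@mul0cm I).

(* (k, m) encodes the Laurent monomial u_1 ^ k * prod_j u_(j+2) ^ (m j). *)

Definition fdb_monom := (int * {cmonom nat})%type.
HB.instance Definition _ := GRing.Nmodule.on fdb_monom.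

Definition laurent_pow (A : nzRingType) (a a' : A) (k : int) : A :=
  match k with Posz n => a ^+ n | Negz n => a' ^+ n.+1 end.

Section FaaDiBruno.
Variable K : fieldType.

Definition HFdB := monoid_algebra K fdb_monom.

(* The tensor square of HFdB as an algebra: the underlying space is the *)
(* space {malg K[fdb_monom * fdb_monom]} containing tens.               *)
Definition HFdB2 := monoid_algebra K (fdb_monom * fdb_monom)%type.

HB.instance Definition _ := GRing.ComAlgebra.on HFdB.
HB.instance Definition _ := GRing.ComAlgebra.on HFdB2.

(* fdb_u n is u_n for n >= 1; fdb_u 0 is a dummy value *)
Definition fdb_u (n : nat) : HFdB :=
  match n with
  | 0 => 0
  | 1 => basis K ((1%Z, 0) : fdb_monom)
  | j.+2 => basis K ((0%Z, ucm j) : fdb_monom)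
  end.

Definition fdb_u1_inv : HFdB := basis K ((- 1%Z, 0) : fdb_monom).

(* partial Bell polynomial B_{n,k}(a_1, ..., a_n): e i is the exponent   *)
(* k_(i+1), bounded by k in every term of the sum. The divisions in K make *)
(* this the Bell polynomial in characteristic 0 only.                      *)
Definition bell (A : comAlgType K) (n k : nat) (a : nat -> A) : A :=
  \sum_(e : {ffun 'I_n -> 'I_k.+1} |
        (\sum_(i < n) e i == k)%N && (\sum_(i < n) i.+1 * e i == n)%N)
    ((n`!)%:R / (\prod_(i < n) (e i)`!)%:R : K) *:
      \prod_(i < n) ((i.+1)`!%:R^-1 *: a i.+1) ^+ e i.

(* the algebra map HFdB -> A with u_1 |-> a, u_1^-1 |-> a' and           *)
(* u_(j+2) |-> b j                                                       *)
Definition fdb_eval (A : comAlgType K) (a a' : A) (b : nat -> A)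
    (h : HFdB) : A :=
  linext (fun m : fdb_monom =>
    laurent_pow a a' m.1 * \prod_(j <- finsupp m.2) b j ^+ m.2 j) h.

HB.instance Definition _ (A : comAlgType K) (a a' : A) (b : nat -> A) :=
  GRing.isLinear.Build K HFdB A *:%R (fdb_eval a a' b) (linext_is_linear _).

Section Eval.
Variables (A : comAlgType K) (a a' : A).
Hypothesis aa : a * a' = 1.

Lemma laurent_powS k : laurent_pow a a' (k + 1) = laurent_pow a a' k * a.
Proof.
case: k => n; first by rewrite -[Posz n + 1]/(Posz (n + 1)) addn1 /= exprSr.
rewrite NegzE; case: n => [|n]; first by rewrite addNr /= expr1 mulrC aa.
have -> : - n.+2%:Z + 1 = Negz n by rewrite NegzE -addn1 PoszD opprD addrNK.
by rewrite -NegzE /= [in RHS]exprSr -mulrA [a' * a]mulrC aa mulr1.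
Qed.

Lemma laurent_powDn k (n : nat) :
  laurent_pow a a' (k + n%:Z) = laurent_pow a a' k * a ^+ n.
Proof.
elim: n k => [|n IH] k; first by rewrite addr0 mulr1.
by rewrite -addn1 PoszD addrA laurent_powS IH addn1 exprSr mulrA.
Qed.

Lemma laurent_powD k l :
  laurent_pow a a' (k + l) = laurent_pow a a' k * laurent_pow a a' l.
Proof.
case: l => n; first exact: laurent_powDn.
rewrite -[k in RHS](subrK n.+1%:Z) laurent_powDn -mulrA -NegzE /=.
by rewrite -exprMn aa expr1n mulr1.
Qed.

Lemma fdb_evalU b (m : fdb_monom) : fdb_eval a a' b (basis K m) =
  laurent_pow a a' m.1 * \prod_(j <- finsupp m.2) b j ^+ m.2 j.
Proof. by rewrite /fdb_eval linext_basis. Qed.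

Lemma fdb_evalM b : {morph fdb_eval a a' b : f g / f * g}.
Proof.
apply: linear_extM; first exact: linearP.
move=> p q; rewrite 3!fdb_evalU [(p + q).1]/= [(p + q).2]/= laurent_powD.
rewrite mulrACA; congr (_ * _).
have E (d : {fset nat}) (m : {cmonom nat}) : (finsupp m `<=` d)%fset ->
  \prod_(j <- finsupp m) b j ^+ m j = \prod_(j <- d) b j ^+ m j.
  move=> le; rewrite (big_fset_incl _ le) // => j _.
  by rewrite -cmE_eq0 => /eqP ->; rewrite expr0.
rewrite (E (finsupp p.2 `|` finsupp q.2)%fset (p.2 + q.2)); last first.
  by rewrite -[p.2 + q.2]/(mmul p.2 q.2) mdomD.
rewrite (E _ p.2 (fsubsetUl _ (finsupp q.2))).
rewrite (E _ q.2 (fsubsetUr (finsupp p.2) _)).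
rewrite -big_split /=; apply: eq_bigr => j _.
by rewrite -[p.2 + q.2]/(mmul p.2 q.2) cmM exprD.
Qed.

Lemma fdb_eval1 b : fdb_eval a a' b 1 = 1.
Proof.
rewrite -[X in fdb_eval _ _ _ X]/(basis K (0 : fdb_monom)).
by rewrite /fdb_eval linext_basis /= mdom1 big_seq_fset0 mulr1.
Qed.

Lemma fdb_eval_u1 b : fdb_eval a a' b (fdb_u 1) = a.
Proof. by rewrite /fdb_eval linext_basis /= mdom1 big_seq_fset0 mulr1. Qed.

Lemma fdb_eval_u1i b : fdb_eval a a' b fdb_u1_inv = a'.
Proof. by rewrite /fdb_eval linext_basis /= mdom1 big_seq_fset0 mulr1. Qed.

Lemma fdb_eval_uS b j : fdb_eval a a' b (fdb_u j.+2) = b j.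
Proof. by rewrite /fdb_eval linext_basis /= mdomU big_seq_fset1 cmUU mul1r. Qed.

End Eval.

Definition fdb_comul_u (n : nat) : HFdB2 :=
  \sum_(1 <= k < n.+1) tens (fdb_u k) (bell n k fdb_u).

Definition fdb_comul : HFdB -> HFdB2 :=
  fdb_eval (fdb_comul_u 1) (tens fdb_u1_inv fdb_u1_inv)
    (fun j => fdb_comul_u j.+2).

Definition fdb_counit : HFdB -> K^o := fdb_eval 1 1 (fun=> 0).

HB.instance Definition _ := GRing.Linear.on fdb_comul.
HB.instance Definition _ := GRing.Linear.on fdb_counit.

Lemma fdb_u1V : fdb_u 1 * fdb_u1_inv = 1.
Proof.
rewrite ma_basisM /= -[RHS]/(basis K (0 : fdb_monom)); congr (basis K _).
by apply/eqP; rewrite xpair_eqE /= add0r.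
Qed.

Lemma bell_u1 : bell 1 1 fdb_u = fdb_u 1.
Proof.
rewrite /bell (eq_bigl (xpred1 [ffun=> inord 1])) => [|e].
  rewrite big_pred1_eq !big_ord1 ffunE inordK // divr1 scale1r.
  by rewrite expr1 invr1 scale1r.
rewrite !big_ord1 mul1n andbb; apply/eqP/eqP=> [e1|->]; last first.
  by rewrite ffunE inordK.
by apply/ffunP=> i; rewrite (ord1 i) ffunE; apply/val_inj; rewrite /= inordK.
Qed.

Lemma fdb_comul_u1E : fdb_comul_u 1 = tens (fdb_u 1) (fdb_u 1).
Proof. by rewrite /fdb_comul_u big_nat1 bell_u1. Qed.

Lemma fdb_comul_u1V : fdb_comul_u 1 * tens fdb_u1_inv fdb_u1_inv = 1 :> HFdB2.
Proof. by rewrite fdb_comul_u1E -[LHS]tensM fdb_u1V tensUU. Qed.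

Lemma fdb_comulM : {morph fdb_comul : f g / f * g}.
Proof. exact: fdb_evalM fdb_comul_u1V _. Qed.

Lemma fdb_comul1 : fdb_comul (1 : HFdB) = 1.
Proof. exact: fdb_eval1. Qed.

Lemma fdb_comul_u1_inv : fdb_comul fdb_u1_inv =
  tens fdb_u1_inv fdb_u1_inv.
Proof. exact: fdb_eval_u1i. Qed.

Lemma fdb_comulE n : (0 < n)%N ->
  fdb_comul (fdb_u n) = \sum_(1 <= k < n.+1) tens (fdb_u k) (bell n k fdb_u).
Proof. case: n => [//|[|n]] _; [exact: fdb_eval_u1|exact: fdb_eval_uS]. Qed.

Lemma fdb_counitM : {morph fdb_counit : f g / f * g}.
Proof. by apply: fdb_evalM; rewrite mulr1. Qed.

Lemma fdb_counitE n : (0 < n)%N -> fdb_counit (fdb_u n) = (n == 1%N)%:R.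
Proof. case: n => [//|[|n]] _; [exact: fdb_eval_u1|exact: fdb_eval_uS]. Qed.

Definition fdb_coalgebra : coalgebra_data K fdb_monom :=
  CoalgebraData fdb_comul fdb_counit.

Definition fdb_x (m : nat) : HFdB := fdb_u m.+1 * fdb_u1_inv.

Definition fdb_z (n : nat) : HFdB :=
  fdb_x n - ((n.+1)`!%:R / 2 ^+ n : K) *: fdb_x 1 ^+ n.

(* s 1 is the exponent of x_1 and s i that of z_i for 2 <= i < N *)
Definition fdb_F (n : nat) : HFdB -> Prop :=
  span (fun h => exists (N : nat) (s : nat -> nat),
    (\sum_(2 <= i < N) (i - 1) * s i + s 1 <= n)%N /\
    h = (\prod_(2 <= i < N) fdb_z i ^+ s i) * fdb_x 1 ^+ s 1).

Definition fdb_laurent_x : HFdB -> Prop :=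
  span (fun h => exists k : int, h = laurent_pow (fdb_u 1) fdb_u1_inv k).

Definition fdb_calF (n : nat) : HFdB -> Prop :=
  span (fun h => exists f g, [/\ fdb_F n f, fdb_laurent_x g & h = f * g]).

End FaaDiBruno.

(* Main.v *)
Require Import Defs.
From HB Require Import structures.
From Stdlib Require Import Classical.
From mathcomp Require Import all_boot all_order all_algebra.
From mathcomp Require Import finmap xfinmap monalg.
From mathcomp Require Import ring zify.

Set Implicit Arguments.
Unset Strict Implicit.
Unset Printing Implicit Defensive.

Import GRing.Theory.

Local Open Scope ring_scope.

(** H_FdB is the algebra of functions on the group of formal series
f(t) = sum u_n t^n / n! with u_1 invertible, under composition. Precomposing f
with t + e t^(j+2)/(j+2)!, to first order in e, gives for each j a derivation
D_j of H_FdB with D_j u_n = C(n, j+2) u_(n-j-1), and D_j = (id # l_j) Delta,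
where # is the tensor product and l_j the tangent vector at the identity dual
to u_(j+2). Being invariant, D_j satisfies Delta D_j = (id # D_j) Delta, and
[D_0, D_j] is a multiple of D_(j+1), nonzero for j >= 1 in characteristic 0
([vfield_spec]). All these facts are checked on generators; the Bell
polynomials enter through the identity
B_(n,k) = (n!/k!) [T^n] (sum u_i T^i / i!)^k ([bellE]).

The z_n are adapted to these derivations because they vanish on the Moebius
series x t / (1 - c t), where x_n = (n+1)! c^n: one finds
D_0 z_n = C(n+1, 2) z_(n-1) with z_1 = 0, and D_j z_n = C(n+1, j+2) x_(n-j-1)
for j >= 1. The algebra H_FdB is the polynomial ring in x_1, z_2, z_3, ... over
K[x, x^-1]. Give x degree 0, x_1 degree 1 and z_n degree n - 1; then F_n is the
space of elements of degree at most n ([calF_fdb_filt], [fdb_filt_calF]).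
Number the variables y_0 = x_1, y_j = z_(j+1), of degree d_j = max(j, 1).
Then D_j lowers degrees by d_j, kills y_i for i < j and sends y_j to 1. Looking
at a monomial of top degree whose last variable y_j is as late as possible, one
sees that h has degree at most n as soon as every D_j h has degree at most
n - d_j ([deriv_criterion]). As the brackets produce all D_j from D_0 and D_1,
it is enough that D_0 h and D_1 h have degree at most n - 1 ([filt_two]).

This criterion carries the three parts of the theorem.

- The coradical is F_0. A subcoalgebra is stable under the D_j, so any nonzero
  element of it can be differentiated down to a nonzero element of
  F_0 = K[x, x^-1], and hence the subcoalgebra contains a group-like x^k; a
  simple one is the line of x^k ([coradical_fdb]).

- F_n is contained in both wedges. Write Delta h as the sum, over the monomials
  m in x, x_1, z_2, ..., of m # h_m. The h_m with deg m > n vanish if h is in F_n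
  ([Delta_lfilt]); since D_j h has components D_j h_m, the criterion gives by
  induction that h_m has degree at most n - deg m ([filt_sl]).

- Both wedges are contained in F_n. If Delta h is in
  F_(n-1) # H + H # F_0, applying id # l_j, which kills the second summand,
  shows that D_j h is in F_(n-1). If Delta h is in H # F_(n-1) + F_0 # H, then the
  components of D_j h satisfy the same condition for n - 1, so an induction on n
  puts D_j h in F_(n-1) ([filt_of_sl]). In both cases the criterion applies. *)

(** * Bell polynomials as coefficients of powers *)

(** Here [s i] stands for 1 / i!, in a ring that need not contain the
rationals. *)
Section Multinomial.
Variables (R : comNzRingType) (s : nat -> R).
Hypothesis sE : forall i, s i * i`!%:R = 1.

Lemma divpowD (c d : R) k :
  s k * (c + d) ^+ k =
  \sum_(i < k.+1) (s i * c ^+ i) * (s (k - i)%N * d ^+ (k - i)).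
Proof.
rewrite addrC exprDn mulr_sumr; apply: eq_bigr => -[i /=]; rewrite ltnS => ik _.
have -> : s k = s i * s (k - i)%N * (s k * (i`! * (k - i)`!)%:R).
  rewrite natrM; transitivity (s k * (s i * i`!%:R) * (s (k - i)%N * (k - i)`!%:R)).
    by rewrite !sE !mulr1.
  ring.
transitivity (s i * s (k - i)%N * c ^+ i * d ^+ (k - i) *
   (s k * ('C(k, i) * (i`! * (k - i)`!))%:R)).
  by rewrite -mulr_natr natrM; ring.
by rewrite bin_fact // sE mulr1; ring.
Qed.

(** The multinomial theorem in divided powers. It is the statement that truncated
exponentials in an extra variable turn sums into products, read off in degree
[k]: this avoids any induction on the exponents [e]. *)
Lemma divpow_sum n (c : 'I_n -> R) k :
  s k * (\sum_i c i) ^+ k =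
  \sum_(e : {ffun 'I_n -> 'I_k.+1} | (\sum_i e i == k)%N)
     \prod_i (s (e i) * c i ^+ e i).
Proof.
pose E x := \sum_(j < k.+1) (s j * x ^+ j)%:P * 'X^j.
have s0 : s 0 = 1 by rewrite -(sE 0) mulr1.
have EE x j : (j <= k)%N -> (E x)`_j = s j * x ^+ j.
  move=> jk; rewrite /E coef_sum (bigD1 (inord j)) //= inordK //.
  rewrite coefCM coefXn eqxx mulr1 big1 ?addr0 // => i /eqP ij.
  rewrite coefCM coefXn; case: eqP => [ji|]; last by rewrite mulr0.
  by case: ij; apply: val_inj; rewrite /= inordK.
have PE j : (j <= k)%N -> (\prod_i E (c i))`_j = s j * (\sum_i c i) ^+ j.
  elim: n c j => [|n IH] c j jk.
    rewrite !big_ord0 coef1; case: j {jk} => [|j]; first by rewrite s0 expr0 mulr1.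
    by rewrite expr0n mulr0.
  rewrite !big_ord_recl coefM divpowD; apply: eq_bigr => -[i /= ij] _.
  by rewrite EE ?IH //; lia.
rewrite -PE // bigA_distr_bigA /= coef_sum [RHS]big_mkcond /=.
apply: eq_bigr => e _; rewrite big_split /= -rmorph_prod coefCM.
have -> : \prod_(i < n) 'X^(e i) = 'X^(\sum_i e i) :> {poly R}.
  by rewrite expr_sum.
by rewrite coefXn eq_sym; case: eqP; rewrite ?mulr1 ?mulr0.
Qed.

End Multinomial.

Section Bell.
Variables (K : fieldType) (A : comAlgType K).
Hypothesis K0 : [pchar K] =i pred0.

Lemma pchar0_natr_neq0 n : (0 < n)%N -> n%:R != 0 :> K.
Proof. by case: n => // n _; rewrite ((pcharf0P _).1 K0). Qed.

Lemma pchar0_factr_neq0 n : n`!%:R != 0 :> K.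
Proof. by rewrite pchar0_natr_neq0 // fact_gt0. Qed.

(** The exponential generating series of [a_1, ..., a_N], without constant term. *)
Definition egf (N : nat) (a : nat -> A) : {poly A} :=
  \sum_(i < N) ((i.+1)`!%:R^-1 *: a i.+1)%:P * 'X^(i.+1).

Lemma coef_egf N a i :
  (egf N a)`_i = if (0 < i <= N)%N then i`!%:R^-1 *: a i else 0.
Proof.
rewrite coef_sum; case: ifP => [/andP[i0 iN]|iN].
  have ltiN : (i.-1 < N)%N by rewrite prednK.
  rewrite (bigD1 (Ordinal ltiN)) //= coefCM coefXn prednK // eqxx mulr1.
  rewrite big1 ?addr0 // => j /eqP ij; rewrite coefCM coefXn.
  by case: eqP => [E|]; rewrite ?mulr0 //; case: ij; apply: val_inj; rewrite /= E.
rewrite big1 // => j _; rewrite coefCM coefXn; case: eqP => [E|]; rewrite ?mulr0 //.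
by rewrite E ltn_ord in iN.
Qed.

(** In the multinomial expansion of the [k]-th power of the generating series, the
exponent of ['X] records the second constraint on [e] in the definition of the
Bell polynomial. *)
Lemma bellE n k (a : nat -> A) :
  bell n k a = (n`!%:R / k`!%:R : K) *: (egf n a ^+ k)`_n.
Proof.
pose s i : {poly A} := ((i`!%:R^-1 : K)%:A)%:P.
have sE i : s i * i`!%:R = 1.
  by rewrite mulr_natr /s -raddfMn /= scalerMnl -mulr_natr mulVf ?pchar0_factr_neq0 ?scale1r.
have : (s k * egf n a ^+ k)`_n = (k`!%:R^-1 : K) *: (egf n a ^+ k)`_n.
  by rewrite coefCM -scalerAl mul1r.
rewrite -scalerA => <-; rewrite divpow_sum // coef_sum scaler_sumr /bell.
rewrite big_mkcondr /=; apply: eq_bigr => e _.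
have -> : \prod_(i < n) (s (e i) * (((i.+1)`!%:R^-1 *: a i.+1)%:P * 'X^(i.+1)) ^+ e i)
  = ((\prod_(i < n) (e i)`!%:R^-1 : K) *:
      \prod_(i < n) ((i.+1)`!%:R^-1 *: a i.+1) ^+ e i)%:P
    * 'X^(\sum_(i < n) i.+1 * e i).
  rewrite expr_sum -scaler_prod rmorph_prod -big_split /=.
  apply: eq_bigr => i _; rewrite exprMn -exprM mulrA -polyC_exp.
  by rewrite /s -polyCM -scalerAl mul1r.
rewrite coefCM coefXn eq_sym; case: eqP; rewrite ?mulr1 ?mulr0 ?scaler0 // => _.
by rewrite scalerA natr_prod prodfV.
Qed.
End Bell.

(** * Derivations and characters on Bell polynomials *)

Section CoefTrunc.
Variable R : comNzRingType.
Implicit Types p q : {poly R}.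

Lemma coefM_trunc p p' q q' n :
  (forall i, (i <= n)%N -> p`_i = p'`_i) ->
  (forall i, (i <= n)%N -> q`_i = q'`_i) ->
  forall i, (i <= n)%N -> (p * q)`_i = (p' * q')`_i.
Proof.
move=> pE qE i le_in; rewrite !coefM; apply: eq_bigr => -[j /= le_ji] _.
by rewrite pE ?qE //; lia.
Qed.

Lemma coef_exp_trunc p p' n k :
  (forall i, (i <= n)%N -> p`_i = p'`_i) ->
  forall i, (i <= n)%N -> (p ^+ k)`_i = (p' ^+ k)`_i.
Proof.
move=> pE; elim: k => [|k IH] //.
by rewrite !exprS; apply: coefM_trunc.
Qed.

End CoefTrunc.

(** A derivation [d] along an algebra morphism [rho] covers at once the derivations of
an algebra ([rho] the identity) and the tangent vectors at a character. *)
Section AlongMorphism.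
Variables (K : fieldType) (A B : comAlgType K) (rho d : {linear A -> B}).
Hypothesis rho1 : rho 1 = 1.
Hypothesis rhoM : {morph rho : x y / x * y}.
Hypothesis dM : forall x y, d (x * y) = d x * rho y + rho x * d y.

Lemma deriv1 : d 1 = 0.
Proof.
have := dM 1 1; rewrite rho1 !mulr1 mul1r => E.
by apply: (addrI (d 1)); rewrite addr0 -E.
Qed.

Lemma map_morph_exp (p : {poly A}) k :
  map_poly rho (p ^+ k) = map_poly rho p ^+ k.
Proof.
elim: k => [|k IH].
  by apply/polyP=> i; rewrite coef_map_id0 ?linear0 // !expr0 !coef1; case: eqP; rewrite ?linear0.
rewrite !exprS -IH; apply/polyP=> i; rewrite coef_map_id0 ?linear0 // !coefM.
rewrite linear_sum; apply: eq_bigr => j _.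
by rewrite rhoM !coef_map_id0 ?linear0.
Qed.

Lemma map_deriv_exp (p : {poly A}) k :
  map_poly d (p ^+ k) = (map_poly rho p ^+ k.-1 *+ k) * map_poly d p.
Proof.
elim: k => [|k IH].
  apply/polyP=> i; rewrite mulr0n mul0r coef0 coef_map_id0 ?linear0 // expr0 coef1.
  by case: eqP; rewrite ?linear0 ?deriv1.
transitivity (map_poly d p * map_poly rho p ^+ k + map_poly rho p * map_poly d (p ^+ k)).
  rewrite exprS -map_morph_exp; apply/polyP=> i.
  rewrite coefD coef_map_id0 ?linear0 // !coefM.
  rewrite linear_sum -big_split /=; apply: eq_bigr => j _.
  by rewrite dM !coef_map_id0 ?linear0.
rewrite IH; case: k {IH} => [|k /=].
  by rewrite mulr0n mul0r mulr0 addr0 !expr0 mulr1 mulr1n mul1r.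
by rewrite [map_poly d p * _]mulrC mulrA mulrnAr -exprS -mulrDl -mulrS.
Qed.

End AlongMorphism.

Lemma bin_fracE (K : fieldType) (K0 : [pchar K] =i pred0) (n m : nat) :
  (m <= n)%N -> 'C(n, m)%:R = n`!%:R / (m`!%:R * (n - m)`!%:R) :> K.
Proof.
move=> mn; apply: (canRL (mulfK _)); first by rewrite mulf_neq0 ?pchar0_factr_neq0.
by rewrite -(natrM K m`!) -natrM bin_fact.
Qed.

Section BellValues.
Variables (K : fieldType) (A : comAlgType K).
Hypothesis K0 : [pchar K] =i pred0.
Variable u : nat -> A.

Lemma egf_factor N : exists q : {poly A},
  egf N u = 'X * q /\ ((0 < N)%N -> q`_0 = u 1%N).
Proof.
exists (\poly_(i < N) (egf N u)`_i.+1); split.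
  apply/polyP=> -[|i]; rewrite coefXM /= ?coef_egf // coef_poly coef_egf /=.
  by case: ltnP.
by move=> N0; rewrite coef_poly N0 coef_egf N0 invr1 scale1r.
Qed.

Lemma bell_small n k : (n < k)%N -> bell n k u = 0.
Proof.
move=> nk; rewrite bellE //; have [q [-> _]] := egf_factor n.
by rewrite exprMn coefXnM nk scaler0.
Qed.

Lemma bell_diag n : bell n n u = u 1%N ^+ n.
Proof.
rewrite bellE // divff ?pchar0_factr_neq0 // scale1r.
case: n => [|n]; first by rewrite !expr0 coef1.
have [q [-> q0]] := egf_factor n.+1.
rewrite exprMn coefXnM ltnn subnn -horner_coef0.
by rewrite horner_exp horner_coef0 q0.
Qed.

(** If [f] is the generating series of [u], the hypothesis says that [d f] is
T^(r+1)/(r+1)! times f'. Both sides being derivations in [f], the same holds for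
the powers of [f]; the claim is the coefficient of T^n. *)
Lemma bell_deriv r (d : {linear A -> A}) n k :
  (forall x y, d (x * y) = d x * y + x * d y) ->
  (forall i, (0 < i)%N -> d (u i) = 'C(i, r.+1)%:R *: u (i - r)%N) ->
  d (bell n k u) = 'C(n, r.+1)%:R *: bell (n - r) k u.
Proof.
move=> dM du; pose c : K := (r.+1)`!%:R^-1.
have binE i : (r < i)%N -> 'C(i, r.+1)%:R = i`!%:R * c / (i - r.+1)`!%:R :> K.
  move=> ri; rewrite bin_fracE // /c; move: (_`!%:R) (_`!%:R) (_`!%:R) => x y z.
  by rewrite invfM mulrA.
have fS i : (r < i)%N -> (i - r)`!%:R = (i - r)%:R * (i - r.+1)`!%:R :> K.
  move=> ri; rewrite -natrM; congr (_%:R).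
  by rewrite subnS -{1}(prednK (n := i - r)) ?factS ?prednK //; lia.
(* the equality d f = c T^(r+1) f' holds up to degree n only, as f is truncated *)
pose f := egf n u; pose g := c%:A%:P * ('X^(r.+1) * f^`()).
have coefg (q : {poly A}) i : (c%:A%:P * ('X^(r.+1) * q^`()))`_i =
    if (r < i)%N then (c * (i - r)%:R) *: q`_(i - r) else 0.
  rewrite coefCM -scalerAl mul1r coefXnM ltnS; case: ltnP => ri; last by rewrite scaler0.
  by rewrite coef_deriv -subSn // subSS -scalerA scaler_nat.
have df i : (i <= n)%N -> (map_poly d f)`_i = g`_i.
  move=> le_in; rewrite coef_map_id0 ?linear0 // /g coefg.
  rewrite !coef_egf; case: (posnP i) => [-> //=|i0]; first by rewrite linear0.
  rewrite le_in /= linearZ /= du //; case: ltnP => ri; last by rewrite bin_small // scale0r scaler0.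
  rewrite subn_gt0 ri (leq_trans (leq_subr _ _)) //= !scalerA; congr (_ *: _).
  rewrite binE // fS //.
  have ir0 : (i - r)%:R != 0 :> K.
    by apply: (pchar0_natr_neq0 K0); rewrite subn_gt0.
  move: (pchar0_factr_neq0 K0 i) (pchar0_factr_neq0 K0 (i - r.+1)%N) ir0.
  set x : K := i`!%:R; set y : K := (i - r.+1)`!%:R; set z : K := (i - r)%:R.
  by move: x y z (c) => x y z c1 x0 y0 z0; field; rewrite x0 y0 z0.
have dfk : (map_poly d (f ^+ k))`_n = (c%:A%:P * ('X^(r.+1) * (f ^+ k)^`()))`_n.
  rewrite (@map_deriv_exp _ _ _ idfun) //.
  have -> : map_poly (@idfun A) f = f by apply: map_poly_id.
  rewrite deriv_exp -!mulrnAl.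
  rewrite (_ : c%:A%:P * _ = (f ^+ k.-1 *+ k) * g); last first.
    by rewrite /g !mulrnAl !mulrnAr; congr (_ *+ _); ring.
  by apply: (@coefM_trunc _ _ _ _ _ n).
rewrite !bellE // linearZ /=; have := dfk; rewrite coef_map_id0 ?linear0 //.
rewrite coefg => ->; case: ltnP => ri; last by rewrite bin_small // scale0r scaler0.
(* the two sides use different truncations of the generating series *)
rewrite (@coef_exp_trunc _ (egf (n - r) u) f (n - r)) //; last first.
  move=> i le_i; rewrite !coef_egf le_i; case: (i <= n)%N / boolP => //; lia.
rewrite !scalerA; congr (_ *: _).
by rewrite binE // fS //; field; rewrite !pchar0_factr_neq0.
Qed.

End BellValues.

(** As [eps] is evaluation at the identity series, it sends the generating series of
[u] to ['X]. *)
Section BellFunctionals.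
Variables (K : fieldType) (A : comAlgType K).
Hypothesis K0 : [pchar K] =i pred0.
Variables (u : nat -> A) (eps : {linear A -> K^o}).
Hypothesis eps1 : eps 1 = 1.
Hypothesis epsM : {morph eps : x y / x * y}.
Hypothesis epsu : forall i, (0 < i)%N -> eps (u i) = (i == 1%N)%:R.

Lemma map_eps_egf n : (0 < n)%N -> map_poly eps (egf n u) = 'X.
Proof.
move=> n0; apply/polyP=> i; rewrite coef_map_id0 ?linear0 // coef_egf coefX.
case: i => [|i]; first by rewrite /= linear0.
case: ifP => ni; last by rewrite linear0; case: i ni => //; rewrite n0.
rewrite linearZ /= epsu //; case: eqP => [[->]|]; last by rewrite scaler0.
by rewrite invr1 scale1r.
Qed.

Lemma bell_eps n k : (0 < n)%N -> eps (bell n k u) = (n == k)%:R.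
Proof.
move=> n0; rewrite bellE // linearZ /=.
rewrite -(coef_map_id0 (f:=eps)) ?linear0 // map_morph_exp // map_eps_egf //.
rewrite coefXn; case: eqP => [->|]; last by rewrite scaler0.
by rewrite divff ?pchar0_factr_neq0 // scale1r.
Qed.

Lemma bell_tangent r (la : {linear A -> K^o}) n k : (0 < n)%N ->
  (forall x y, la (x * y) = la x * eps y + eps x * la y) ->
  (forall i, (0 < i)%N -> la (u i) = (i == r.+1)%:R) ->
  la (bell n k u) = (if n == (k + r)%N then 'C(n, r.+1)%:R else 0).
Proof.
move=> n0 laM lau; rewrite bellE // linearZ /=.
rewrite -(coef_map_id0 (f:=la)) ?linear0 // (map_deriv_exp eps1 epsM laM) map_eps_egf //.
rewrite ['X^_ *+ _ * _]mulrnAl coefMn coefXnM coef_map_id0 ?linear0 // coef_egf.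
case: k => [|k]; first by rewrite mulr0n scaler0 add0n; case: eqP => // ->; rewrite bin_small.
rewrite [k.+1.-1]/=; case: ltnP => kn; first by rewrite mul0rn scaler0; case: eqP => //; lia.
case: ifP => nk; last first.
  by rewrite linear0 mul0rn scaler0; case: eqP => //; lia.
rewrite linearZ /= lau; last by case/andP: nk.
have -> : (n - k == r.+1)%N = (n == k.+1 + r)%N by apply/eqP/eqP; lia.
case: eqP => [nE|]; last by rewrite scaler0 mul0rn scaler0.
have -> : (n - k = r.+1)%N by lia.
rewrite (bin_fracE K0); last by lia.
have -> : (n - r.+1 = k)%N by lia.
have k1 : k.+1%:R != 0 :> K by rewrite pchar0_natr_neq0.
rewrite [k.+1`!]factS (natrM K k.+1) /GRing.scale /= -[_^-1 * 1 *+ _]mulr_natr.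
move: (pchar0_factr_neq0 K0 r.+1) (pchar0_factr_neq0 K0 k) k1.
set x : K := r.+1`!%:R; set y : K := k`!%:R; set z : K := n`!%:R; set t : K := k.+1%:R.
by move: x y z t => x y z t x0 y0 t0; field; rewrite x0 y0.
Qed.

End BellFunctionals.

(** * Spans, contractions and extensionality on tensors *)

Section Span.
Variables (K : fieldType) (V : lmodType K) (S : V -> Prop).

Lemma span0 : Defs.span S 0.
Proof. by exists 0, (fun=> 0), (fun=> 0); split=> [[]//|]; rewrite big_ord0. Qed.

Lemma span_in v : S v -> Defs.span S v.
Proof. by exists 1, (fun=> 1), (fun=> v); split=> //; rewrite big_ord1 scale1r. Qed.

Lemma span_lin a v w : Defs.span S v -> Defs.span S w -> Defs.span S (a *: v + w).
Proof.
move=> [n [c [x [xS ->]]]] [m [d [y [yS ->]]]].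
exists (n + m)%N, (fun i => match split i with inl j => a * c j | inr j => d j end),
  (fun i => match split i with inl j => x j | inr j => y j end); split=> [i|].
  by case: split.
rewrite big_split_ord scaler_sumr /=; congr (_ + _); apply: eq_bigr => i _.
  by rewrite (unsplitK (inl i)) scalerA.
by rewrite (unsplitK (inr i)).
Qed.

Lemma span_ind (P : V -> Prop) : P 0 ->
  (forall a v w, P v -> P w -> P (a *: v + w)) -> (forall v, S v -> P v) ->
  forall v, Defs.span S v -> P v.
Proof.
move=> P0 PD PS v [n [c [w [wS ->]]]]; elim: n c w wS => [|n IH] c w wS.
  by rewrite big_ord0.
by rewrite big_ord_recl; apply: PD; [apply: PS|apply: IH].
Qed.

End Span.

Section Contractions.
Variable K : fieldType.

Lemma mcoeff_basis (I : choiceType) (i j : I) : (basis K i)@_j = (i == j)%:R.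
Proof. by rewrite basis.unlock mcoeffU. Qed.

Lemma basis_lin_ext (I : choiceType) (V : lmodType K)
    (L L' : {linear {malg K[I]} -> V}) :
  (forall i, L (basis K i) = L' (basis K i)) -> L =1 L'.
Proof.
by move=> e f; rewrite -[f]linext_id !linext_comp; apply: linext_eq => i /=.
Qed.

Definition contr_r (I J : choiceType) (phi : {malg K[J]} -> K)
    (t : {malg K[(I * J)%type]}) : {malg K[I]} :=
  linext (fun p => phi (basis K p.2) *: basis K p.1) t.

Definition contr_l (I J : choiceType) (phi : {malg K[I]} -> K)
    (t : {malg K[(I * J)%type]}) : {malg K[J]} :=
  linext (fun p => phi (basis K p.1) *: basis K p.2) t.

Definition tmap (I J I' J' : choiceType) (f : {malg K[I]} -> {malg K[I']})
    (g : {malg K[J]} -> {malg K[J']}) (t : {malg K[(I * J)%type]}) :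
    {malg K[(I' * J')%type]} :=
  linext (fun p => tens (f (basis K p.1)) (g (basis K p.2))) t.

HB.instance Definition _ I J phi :=
  GRing.Linear.copy (@contr_r I J phi) (linext _).
HB.instance Definition _ I J phi :=
  GRing.Linear.copy (@contr_l I J phi) (linext _).
HB.instance Definition _ I J I' J' f g :=
  GRing.Linear.copy (@tmap I J I' J' f g) (linext _).

HB.instance Definition _ I J (f : {malg K[I]}) :=
  GRing.isLinear.Build K {malg K[J]} {malg K[(I * J)%type]} *:%R
    (tens f) (tens_linr f).

Section Ext.
Variables (I J : choiceType).

Lemma tens_ext (V : lmodType K)
    (L L' : {linear {malg K[(I * J)%type]} -> V}) :
  (forall f g, L (tens f g) = L' (tens f g)) -> L =1 L'.
Proof. by move=> e; apply: basis_lin_ext => -[i j]; rewrite -tensUU e. Qed.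

Lemma bilin_ext (V : lmodType K) (B B' : {malg K[I]} -> {malg K[J]} -> V) :
  (forall g, linear (B^~ g)) -> (forall f, linear (B f)) ->
  (forall g, linear (B'^~ g)) -> (forall f, linear (B' f)) ->
  (forall i j, B (basis K i) (basis K j) = B' (basis K i) (basis K j)) ->
  forall f g, B f g = B' f g.
Proof.
move=> l1 l2 l1' l2' e f g.
pose Lg h := HB.pack_for {linear {malg K[J]} -> V} (B h)
  (GRing.isLinear.Build K {malg K[J]} V *:%R (B h) (l2 h)).
pose Lg' h := HB.pack_for {linear {malg K[J]} -> V} (B' h)
  (GRing.isLinear.Build K {malg K[J]} V *:%R (B' h) (l2' h)).
pose Lf := HB.pack_for {linear {malg K[I]} -> V} (B^~ g)
  (GRing.isLinear.Build K {malg K[I]} V *:%R (B^~ g) (l1 g)).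
pose Lf' := HB.pack_for {linear {malg K[I]} -> V} (B'^~ g)
  (GRing.isLinear.Build K {malg K[I]} V *:%R (B'^~ g) (l1' g)).
apply: (@basis_lin_ext _ _ Lf Lf') => i.
by apply: (@basis_lin_ext _ _ (Lg (basis K i)) (Lg' (basis K i))) => j; apply: e.
Qed.

End Ext.

Section OnTensors.
Variables (I J I' J' : choiceType).

Lemma contr_r_tens (phi : {linear {malg K[J]} -> K^o}) (f : {malg K[I]}) g :
  contr_r phi (tens f g) = phi g *: f.
Proof.
move: f g; apply: (bilin_ext (B := fun f g => contr_r phi (tens f g))
  (B' := fun f g => phi g *: f)) => [g a f f'|f a g g'|g a f f'|f a g g'|i j].
- by rewrite tens_linl linearP.
- by rewrite !linearP.
- by rewrite scalerDr !scalerA mulrC.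
- by rewrite linearP scalerDl scalerA.
by rewrite tensUU /contr_r linext_basis.
Qed.

Lemma contr_l_tens (phi : {linear {malg K[I]} -> K^o}) f (g : {malg K[J]}) :
  contr_l phi (tens f g) = phi f *: g.
Proof.
move: f g; apply: (bilin_ext (B := fun f g => contr_l phi (tens f g))
  (B' := fun f g => phi f *: g)) => [g a f f'|f a g g'|g a f f'|f a g g'|i j].
- by rewrite tens_linl linearP.
- by rewrite !linearP.
- by rewrite linearP scalerDl scalerA.
- by rewrite scalerDr !scalerA mulrC.
by rewrite tensUU /contr_l linext_basis.
Qed.

Lemma tmap_tens (F : {linear {malg K[I]} -> {malg K[I']}})
    (G : {linear {malg K[J]} -> {malg K[J']}}) f g :
  tmap F G (tens f g) = tens (F f) (G g).
Proof.
move: f g; apply: (bilin_ext (B := fun f g => tmap F G (tens f g))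
  (B' := fun f g => tens (F f) (G g))) => [g a f f'|f a g g'|g a f f'|f a g g'|i j].
- by rewrite tens_linl linearP.
- by rewrite !linearP.
- by rewrite linearP tens_linl.
- by rewrite !linearP.
by rewrite tensUU /tmap linext_basis.
Qed.

End OnTensors.
End Contractions.

(** * Generators of the Faa di Bruno algebra *)

Section Generators.
Variable K : fieldType.
Notation H := (HFdB K).
Notation u := (fdb_u K).

Lemma ucm_addK j (m : {cmonom nat}) : divcm (ucm j + m) (ucm j) = m.
Proof.
by apply/eqP/cmP => l; rewrite divcmE -[ucm j + _]/(mmul _ _) cmM cmU addKn.
Qed.

Lemma ucm_divK j (m : {cmonom nat}) : (0 < m j)%N ->
  ucm j + divcm m (ucm j) = m.
Proof.
move=> mj; apply/eqP/cmP => l; rewrite -[ucm j + _]/(mmul _ _) cmM divcmE cmU.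
by case: eqP => [<-|_]; rewrite ?subnKC // subn0.
Qed.

Lemma ucm_divA i j (m : {cmonom nat}) : i != j -> (0 < m j)%N ->
  ucm i + divcm m (ucm j) = divcm (ucm i + m) (ucm j).
Proof.
move=> ij mj; apply/eqP/cmP => l; rewrite divcmE -![ucm i + _]/(mmul _ _) !cmM.
by rewrite divcmE !cmU addnBA //; case: eqP => [<-|].
Qed.

Lemma cmonom_ind (P : {cmonom nat} -> Prop) :
  P 0 -> (forall m j, P m -> P (ucm j + m)) -> forall m, P m.
Proof.
move=> P0 PS m; have [n] := ubnP (mdeg m); elim: n m => // n IH m; rewrite ltnS => mn.
case: (eqVneq (mdeg m) 0%N) => [/mdeg_eq0I -> //|/eqP d0].
have [j mj] : exists j, (0 < m j)%N.
  case: (finsupp m =P fset0) => [m0|/eqP/fset0Pn[j jm]]; last first.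
    by exists j; rewrite lt0n cmE_neq0.
  by case: d0; rewrite mdegE m0 big_seq_fset0.
rewrite -(ucm_divK mj) in mn *; apply/PS/IH; move: mn.
by rewrite -[ucm j + _]/(mmul _ _) mdegM mdegU.
Qed.

Lemma fdb_monom_ind (P : fdb_monom -> Prop) :
  P 0 -> (forall p, P p -> P ((1%Z, 0) + p)) ->
  (forall p, P p -> P ((-1%Z, 0) + p)) ->
  (forall p j, P p -> P ((0%Z, ucm j) + p)) -> forall p, P p.
Proof.
move=> P0 P1 PN PU [k m]; elim/cmonom_ind: m => [|m j IH]; last first.
  suff -> : (k, ucm j + m) = (0%Z, ucm j) + (k, m) :> fdb_monom by exact: PU.
  by congr pair; rewrite add0r.
elim/int_rect: k => [//|n|n] IH.
  suff -> : (n.+1%:Z, 0) = (1%Z, 0) + (n%:Z, 0) :> fdb_monom by exact: P1.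
  by congr pair; rewrite ?addr0 //= -PoszD.
suff -> : (- n.+1%:Z, 0) = (-1%Z, 0) + (- n%:Z, 0) :> fdb_monom by exact: PN.
by congr pair; rewrite ?addr0 //= -opprD -PoszD.
Qed.

Lemma fdb_alg_ind (P : H -> Prop) :
  (forall a f g, P f -> P g -> P (a *: f + g)) -> P 1 ->
  (forall f, P f -> P (u 1 * f)) -> (forall f, P f -> P (fdb_u1_inv K * f)) ->
  (forall j f, P f -> P (u j.+2 * f)) -> forall f, P f.
Proof.
move=> PD P1 Pu Pv Pj f.
have P0 : P 0 by have := PD (-1) 1 1 P1 P1; rewrite scaleN1r addNr.
have Pb p : P (basis K p).
  elim/fdb_monom_ind: p => [|p Pp|p Pp|p j Pp]; first exact: P1.
  - by rewrite -ma_basisM; apply: Pu.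
  - by rewrite -ma_basisM; apply: Pv.
  - by rewrite -ma_basisM; apply: Pj.
rewrite -[f]linext_id /linext; elim/big_ind: _ => // [g h Pg Ph|p _].
  by rewrite -[g]scale1r; apply: PD.
by rewrite -[X in P X]addr0; apply: PD.
Qed.

End Generators.

(** * Invariant derivations *)

Lemma bracket_ring_id (R : comNzRingType) (f g a b a' b' p q r s : R) :
  a * g + r * s + (p * q + f * b) - (a' * g + p * q + (r * s + f * b')) =
  (a - a') * g + f * (b - b').
Proof. by ring. Qed.

(** The structure constants of [t^2/2 d/dt, t^(j+2)/(j+2)! d/dt]. *)
Lemma bracket_binomial_id (K : fieldType) (K0 : [pchar K] =i pred0) (n j : nat) :
  (j.+1 < n)%N ->
  'C(n, j.+2)%:R * 'C(n - j.+1, 2)%:R - 'C(n, 2)%:R * 'C(n - 1, j.+2)%:R =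
  - ((j * j.+3)%:R / 2) * 'C(n, j.+3)%:R :> K.
Proof.
move=> jn; have [t nE] : exists t, n = (t + j.+2)%N by exists (n - j.+2)%N; lia.
have two0 : 2 != 0 :> K by exact: (@pchar0_natr_neq0 K K0 2).
have bin2E m : 'C(m.+1, 2)%:R = m.+1%:R * m%:R / 2 :> K.
  apply: (canRL (mulfK two0)); rewrite -!natrM; congr (_%:R).
  by rewrite mulnC mul_bin_left bin1 subn1 mulnC.
pose w : K := j.+3%:R * 'C(n, j.+3)%:R.
(* both products of binomials on the left are multiples of w *)
have h1 : t%:R * 'C(n, j.+2)%:R = w.
  by rewrite /w -!natrM mul_bin_left; congr (_ * _)%:R; lia.
have h2 : n%:R * 'C(n - 1, j.+2)%:R = w.
  by rewrite /w -!natrM subn1 mul_bin_diag.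
have n1 : 'C(n, 2)%:R = n%:R * (t + j.+1)%:R / 2 :> K.
  by rewrite nE addnS bin2E.
have -> : (n - j.+1 = t.+1)%N by lia.
have ht : t.+1%:R = t%:R + 1 :> K by rewrite -addn1 natrD.
have hj : (t + j.+1)%:R = t%:R + j%:R + 1 :> K by rewrite addnS -addn1 !natrD.
rewrite n1 bin2E natrM ht hj; move: h1 h2; rewrite /w.
move: ('C(n, j.+2)%:R) ('C(n - 1, j.+2)%:R) ('C(n, j.+3)%:R) => B C D.
move: (n%:R) (j.+3%:R) (j%:R) (t%:R) => x y z s h1 h2.
transitivity ((s + 1) / 2 * (s * B) - (s + z + 1) / 2 * (x * C)).
  by field.
by rewrite h1 h2; field.
Qed.

(** In this section [tn] is the tensor product H x H -> H2, [cr phi] is the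
contraction id # phi, and [tm F] is id # F. Only these laws matter, and the
statements apply to H_FdB and its tensor square. The lemmas all compare
multiplicative maps or derivations, so that they reduce to the generators [u n]
and [v] = u_1^-1. *)
Section InvariantFields.
Variables (K : fieldType) (H H2 : comAlgType K) (tn : H -> H -> H2).
Hypothesis K0 : [pchar K] =i pred0.
Hypothesis tn_linr : forall f, linear (tn f).
Hypothesis tnM : forall a b c d, tn (a * c) (b * d) = tn a b * tn c d.
Hypothesis tn11 : tn 1 1 = 1.
Hypothesis tn_ind : forall P : H2 -> Prop,
  (forall c s t, P s -> P t -> P (c *: s + t)) ->
  (forall f g, P (tn f g)) -> forall t, P t.
Variable cr : (H -> K^o) -> {linear H2 -> H}.
Hypothesis cr_tn : forall (phi : {linear H -> K^o}) f g,
  cr phi (tn f g) = phi g *: f.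
Variable tm : (H -> H) -> {linear H2 -> H2}.
Hypothesis tm_tn : forall (F : {linear H -> H}) f g, tm F (tn f g) = tn f (F g).
Variables (u : nat -> H) (v : H).
Hypothesis H_ind : forall P : H -> Prop,
  (forall a f g, P f -> P g -> P (a *: f + g)) -> P 1 ->
  (forall f, P f -> P (v * f)) ->
  (forall j f, P f -> P (u j.+1 * f)) -> forall f, P f.
Variables (eps : {linear H -> K^o}) (Delta : {linear H -> H2}).
Hypothesis eps1 : eps 1 = 1.
Hypothesis epsM : {morph eps : x y / x * y}.
Hypothesis eps_u : forall i, (0 < i)%N -> eps (u i) = (i == 1%N)%:R.
Hypothesis eps_v : eps v = 1.
Hypothesis Delta1 : Delta 1 = 1.
Hypothesis DeltaM : {morph Delta : x y / x * y}.
Hypothesis Delta_u : forall n, (0 < n)%N ->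
  Delta (u n) = \sum_(1 <= k < n.+1) tn (u k) (bell n k u).
Hypothesis Delta_v : Delta v = tn v v.
Variable lam : nat -> {linear H -> K^o}.
Hypothesis lamM : forall j f g,
  lam j (f * g) = lam j f * eps g + eps f * lam j g.
Hypothesis lam_u : forall j i, (0 < i)%N -> lam j (u i) = (i == j.+2)%:R.
Hypothesis lam_v : forall j, lam j v = 0.

Lemma tn_ind2 (P : H2 -> H2 -> Prop) :
  (forall c s s' t, P s t -> P s' t -> P (c *: s + s') t) ->
  (forall c s t t', P s t -> P s t' -> P s (c *: t + t')) ->
  (forall a b c d, P (tn a b) (tn c d)) -> forall s t, P s t.
Proof.
move=> Pl Pr Pt s t; elim/tn_ind: s => [c s s' Ps Ps'|a b]; first exact: Pl.
by elim/tn_ind: t => [c t t' Pt1 Pt2|c d]; [exact: Pr|exact: Pt].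
Qed.

Lemma cr_epsM s t : cr eps (s * t) = cr eps s * cr eps t.
Proof.
move: s t; apply: tn_ind2 => [c s s' t Hs Hs'|c s t t' Ht Ht'|a b c d].
- by rewrite mulrDl -scalerAl [LHS]linearP /= Hs Hs' linearP /= mulrDl -scalerAl.
- by rewrite mulrDr -scalerAr [LHS]linearP /= Ht Ht' linearP /= mulrDr -scalerAr.
rewrite -tnM !cr_tn epsM -scalerAl -scalerAr.
by rewrite scalerA.
Qed.

Lemma cr_lamM j s t :
  cr (lam j) (s * t) = cr (lam j) s * cr eps t + cr eps s * cr (lam j) t.
Proof.
move: s t; apply: tn_ind2 => [c s s' t Hs Hs'|c s t t' Ht Ht'|a b c d].
- rewrite mulrDl -scalerAl [LHS]linearP /= Hs Hs' !linearP /=.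
  by rewrite !mulrDl -!scalerAl scalerDr addrACA.
- rewrite mulrDr -scalerAr [LHS]linearP /= Ht Ht' !linearP /=.
  by rewrite !mulrDr -!scalerAr scalerDr addrACA.
rewrite -tnM !cr_tn lamM -!scalerAl -!scalerAr.
by rewrite !scalerA scalerDl.
Qed.

Lemma comul_counit h : cr eps (Delta h) = h.
Proof.
have uE n : (0 < n)%N -> cr eps (Delta (u n)) = u n.
  move=> n0; rewrite Delta_u // linear_sum /=.
  under eq_bigr => k _ do rewrite cr_tn (bell_eps K0 eps1 epsM) //.
  rewrite big_nat_recr //= eqxx scale1r big_nat big1 ?add0r // => k /andP[_ kn].
  by rewrite gtn_eqF // scale0r.
move: h; apply: H_ind => [a f g Hf Hg||f Hf|j f Hf].
- by rewrite !linearP Hf Hg.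
- by rewrite Delta1 -tn11 cr_tn eps1 scale1r.
- by rewrite DeltaM cr_epsM Hf Delta_v cr_tn eps_v scale1r.
- by rewrite DeltaM cr_epsM Hf uE.
Qed.

Definition inv_field (j : nat) (h : H) : H := cr (lam j) (Delta h).

Lemma inv_field_is_linear j : linear (inv_field j).
Proof. by move=> a f g; rewrite /inv_field !linearP. Qed.
HB.instance Definition _ j := GRing.isLinear.Build K H H *:%R (inv_field j)
  (inv_field_is_linear j).

Lemma inv_fieldM j f g : inv_field j (f * g) = inv_field j f * g + f * inv_field j g.
Proof. by rewrite {1}/inv_field DeltaM cr_lamM !comul_counit. Qed.

Lemma inv_field1 j : inv_field j 1 = 0.
Proof.
have := inv_fieldM j 1 1; rewrite !mulr1 mul1r => E.
by apply: (addrI (inv_field j 1)); rewrite addr0 -E.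
Qed.

Lemma inv_field_u j n : (0 < n)%N ->
  inv_field j (u n) = 'C(n, j.+2)%:R *: u (n - j.+1)%N.
Proof.
move=> n0; rewrite /inv_field Delta_u // linear_sum /=.
under eq_bigr => k _ do rewrite cr_tn
  (bell_tangent K0 eps1 epsM eps_u _ n0 (lamM j) (@lam_u j)).
case: (ltnP j.+1 n) => jn; last first.
  rewrite bin_small // scale0r big_nat big1 // => k /andP[k0 kn].
  by case: eqP => [E|]; rewrite ?scale0r //; lia.
rewrite (bigD1_seq (n - j.+1)%N) ?iota_uniq ?mem_index_iota /=; last 2 first.
- by lia.
- by [].
rewrite subnK ?(ltnW jn) // eqxx big1 ?addr0 // => k /eqP kn.
by case: eqP => [E|]; rewrite ?scale0r //; lia.
Qed.

Lemma inv_field_v j : inv_field j v = 0.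
Proof. by rewrite /inv_field Delta_v cr_tn lam_v scale0r. Qed.

Lemma tm_inv_fieldM j s t : tm (inv_field j) (s * t) =
  tm (inv_field j) s * t + s * tm (inv_field j) t.
Proof.
move: s t; apply: tn_ind2 => [c s s' t Hs Hs'|c s t t' Ht Ht'|a b c d].
- rewrite mulrDl -scalerAl [LHS]linearP /= Hs Hs' !linearP /=.
  by rewrite !mulrDl -!scalerAl scalerDr addrACA.
- rewrite mulrDr -scalerAr [LHS]linearP /= Ht Ht' !linearP /=.
  by rewrite !mulrDr -!scalerAr scalerDr addrACA.
rewrite -tnM !tm_tn /= inv_fieldM -!tnM.
by have := tn_linr (a * c) 1 (inv_field j b * d) (b * inv_field j d); rewrite !scale1r.
Qed.

(** Invariance replaces coassociativity in what follows. Both sides are derivations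
along [Delta], and on [u n] the equality is [bell_deriv]. *)
Lemma comul_inv_field j h : Delta (inv_field j h) = tm (inv_field j) (Delta h).
Proof.
have tn0 f : tn f 0 = 0.
  by have := tn_linr f (-1) 0 0; rewrite scaleN1r addNr scaleN1r addNr.
have uE n : (0 < n)%N -> Delta (inv_field j (u n)) = tm (inv_field j) (Delta (u n)).
  move=> n0; rewrite inv_field_u // linearZ /= [in RHS]Delta_u // linear_sum /=.
  have -> : \sum_(1 <= k < n.+1) tm (inv_field j) (tn (u k) (bell n k u)) =
    'C(n, j.+2)%:R *: \sum_(1 <= k < n.+1) tn (u k) (bell (n - j.+1) k u).
    rewrite scaler_sumr; apply: eq_bigr => k _.
    rewrite tm_tn /= (bell_deriv K0 _ _ (inv_fieldM j) (@inv_field_u j)).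
    by have := tn_linr (u k) ('C(n, j.+2)%:R) (bell (n - j.+1) k u) 0; rewrite tn0 !addr0.
  case: (ltnP j.+1 n) => jn; last by rewrite bin_small // !scale0r.
  rewrite Delta_u ?subn_gt0 //; congr (_ *: _).
  rewrite [RHS](big_cat_nat (n := (n - j.+1).+1)) //=; last by lia.
  rewrite [X in _ = _ + X](_ : _ = 0) ?addr0 // big_nat big1 // => k /andP[kn _].
  by rewrite (bell_small K0) // tn0.
move: h; apply: H_ind => [a f g Hf Hg||f Hf|i f Hf].
- by rewrite !linearP Hf Hg.
- by rewrite inv_field1 linear0 Delta1 -tn11 tm_tn /= inv_field1 tn0.
- rewrite DeltaM tm_inv_fieldM inv_fieldM linearD !DeltaM Hf inv_field_v Delta_v.
  by rewrite tm_tn /= inv_field_v tn0 linear0 !mul0r.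
- by rewrite DeltaM tm_inv_fieldM inv_fieldM linearD !DeltaM Hf uE.
Qed.

(** A bracket of derivations is a derivation. *)
Lemma inv_field_bracket j h :
  inv_field 0 (inv_field j h) - inv_field j (inv_field 0 h)
    = - ((j * j.+3)%:R / 2) *: inv_field j.+1 h.
Proof.
pose c : K := - ((j * j.+3)%:R / 2); rewrite -/c.
pose br := fun h => inv_field 0 (inv_field j h) - inv_field j (inv_field 0 h).
have brM f g : br (f * g) = br f * g + f * br g.
  rewrite /br !inv_fieldM !linearD /= !inv_fieldM.
  by rewrite -opprD bracket_ring_id.
have uE n : (0 < n)%N -> br (u n) = c *: inv_field j.+1 (u n).
  move=> n0; rewrite /br (inv_field_u j) // (inv_field_u 0) //.
  rewrite (inv_field_u j.+1) // [inv_field 0 _]linearZ [inv_field j _]linearZ /=.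
  case: (ltnP j.+1 n) => jn; last first.
    rewrite ['C(n, j.+2)]bin_small // ['C(n, j.+3)]bin_small; last by lia.
    rewrite !scale0r scaler0 sub0r; case: (ltnP 1 n) => n1; last first.
      by rewrite bin_small // scale0r oppr0.
    rewrite inv_field_u ?subn_gt0 // ['C(n - 1, _)]bin_small; last by lia.
    by rewrite scale0r scaler0 oppr0.
  rewrite (inv_field_u 0) ?subn_gt0 // (inv_field_u j); last by lia.
  have -> : (n - j.+1 - 1 = n - j.+2)%N by lia.
  have -> : (n - 1 - j.+1 = n - j.+2)%N by lia.
  rewrite !scalerA -scalerBl; congr (_ *: _).
  exact: (bracket_binomial_id K0).
rewrite -/(br h); move: h; apply: H_ind => [a f g Hf Hg||f Hf|i f Hf].
- have -> : br (a *: f + g) = a *: br f + br g.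
    rewrite /br (linearP (inv_field j)) !(linearP (inv_field 0)) (linearP (inv_field j)).
    by rewrite scalerBr opprD addrACA.
  by rewrite Hf Hg linearP /= scalerDr !scalerA mulrC.
- by rewrite /br !inv_field1 !linear0 addr0.
- rewrite brM Hf /br !inv_field_v !linear0 addr0 mul0r.
  by rewrite inv_fieldM inv_field_v mul0r !add0r scalerAr.
- by rewrite brM Hf uE // inv_fieldM scalerDr -scalerAl -scalerAr.
Qed.

Lemma inv_field_spec :
  [/\ forall h, cr eps (Delta h) = h,
      forall j f g, inv_field j (f * g) = inv_field j f * g + f * inv_field j g,
      forall j n, (0 < n)%N ->
        inv_field j (u n) = 'C(n, j.+2)%:R *: u (n - j.+1)%N,
      forall j h, Delta (inv_field j h) = tm (inv_field j) (Delta h)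
    & forall j h, inv_field 0 (inv_field j h) - inv_field j (inv_field 0 h)
        = - ((j * j.+3)%:R / 2) *: inv_field j.+1 h].
Proof.
split; [exact: comul_counit | exact: inv_fieldM | exact: inv_field_u
  | exact: comul_inv_field | exact: inv_field_bracket].
Qed.

End InvariantFields.

Section FdBFields.
Variable K : fieldType.
Hypothesis K0 : [pchar K] =i pred0.
Notation H := (HFdB K).
Notation H2 := (HFdB2 K).
Notation u := (fdb_u K).
Notation v := (fdb_u1_inv K).
Notation eps := (@fdb_counit K).
Notation Delta := (@fdb_comul K).

Lemma counit1 : eps 1 = 1.
Proof. exact: fdb_eval1. Qed.

Lemma counit_v : eps v = 1.
Proof. exact: fdb_eval_u1i. Qed.

Lemma counit_basis p : eps (basis K p) = (p.2 == 0)%:R.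
Proof.
rewrite [LHS]fdb_evalU.
have -> : laurent_pow (1 : K^o) 1 p.1 = 1 by case: p.1 => n /=; rewrite expr1n.
rewrite mul1r; case: eqP => [-> |/eqP p0].
  by rewrite -[0]/(mone : {cmonom nat}) mdom1 big_seq_fset0.
have [j jp] : exists j, j \in finsupp p.2.
  apply/fset0Pn; apply: contraNneq p0 => E.
  by apply/eqP/mdeg_eq0I; rewrite mdegE E big_seq_fset0.
rewrite (bigD1_seq j) //=; move: jp; rewrite -cmE_neq0.
by case: (p.2 j) => // n _; rewrite exprS !mul0r.
Qed.

(** The derivation at the counit dual to u_(j+2). The shift of the index makes
[tangent j] correspond to the [j]-th of the variables x_1, z_2, z_3, ... *)
Definition tangent (j : nat) : H -> K^o :=
  linext (fun p : fdb_monom => (p.2 == ucm j)%:R).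
HB.instance Definition _ j := GRing.Linear.copy (tangent j) (linext _).

Lemma tangent_basis j p : tangent j (basis K p) = (p.2 == ucm j)%:R.
Proof. by rewrite /tangent linext_basis. Qed.

(** This is the Leibniz rule of [tangent j] on monomials. *)
Lemma cmonom_addI_ucm (m m' : {cmonom nat}) j :
  ((m + m' == ucm j) : nat) =
  (((m == ucm j) && (m' == 0%R)) + ((m == 0%R) && (m' == ucm j)))%N.
Proof.
have deg1 (x : {cmonom nat}) : x = ucm j -> mdeg x = 1%N by move=> ->; rewrite mdegU.
have deg0 : mdeg (0 : {cmonom nat}) = 0%N by exact: mdeg1.
case: (m =P 0) => [->|m0].
  rewrite add0r; have -> : (0 == ucm j) = false by apply/eqP => /deg1; rewrite deg0.
  by rewrite andTb andFb.
rewrite addn0; case: (m' =P 0) => [->|m'0]; first by rewrite addr0 andbT.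
rewrite andbF; case: eqP => // /deg1; rewrite -[m + m']/(mmul m m') mdegM.
have := @mdeg_eq0I _ m; have := @mdeg_eq0I _ m'.
case: (mdeg m) => [_ /(_ erefl)/m0 //|a]; case: (mdeg m') => [/(_ erefl)/m'0 //|b].
by rewrite addSn addnS.
Qed.

Lemma tangentM j (f g : H) :
  tangent j (f * g) = tangent j f * eps g + eps f * tangent j g.
Proof.
have Rl (a x x' e e' y l : K) : (a * x + x') * y + (a * e + e') * l =
  a * (x * y + e * l) + (x' * y + e' * l) by ring.
have Rr (a x e y y' l l' : K) : x * (a * y + y') + e * (a * l + l') =
  a * (x * y + e * l) + (x * y' + e * l') by ring.
move: f g; apply: (bilin_ext (V := K^o) (B := fun f g : H => tangent j (f * g))
  (B' := fun f g => tangent j f * eps g + eps f * tangent j g))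
  => [g a f f'|f a g g'|g a f f'|f a g g'|p q].
- by rewrite mulrDl -scalerAl linearP.
- by rewrite mulrDr -scalerAr linearP.
- by rewrite (linearP (tangent j)) (linearP eps); apply: Rl.
- by rewrite (linearP (tangent j)) (linearP eps); apply: Rr.
rewrite ma_basisM !tangent_basis !counit_basis -[(p + q).2]/(p.2 + q.2).
rewrite cmonom_addI_ucm natrD.
by case: (p.2 == _); case: (q.2 == _); case: (p.2 == _); case: (q.2 == _);
  rewrite /= ?mulr1 ?mulr0.
Qed.

Lemma tangent_u j i : (0 < i)%N -> tangent j (u i) = (i == j.+2)%:R.
Proof.
case: i => [//|[|i]] _; rewrite tangent_basis /=.
  by rewrite -[0]/(mone : {cmonom nat}) eq_sym cm1_eq1.
congr (_%:R); congr nat_of_bool; rewrite !eqSS; apply/eqP/eqP => [E|->//].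
have := congr1 (fun m : {cmonom nat} => m i) E; rewrite /= !cmU eqxx.
by case: eqP.
Qed.

Lemma tangent_laurent j k : tangent j (basis K (k, 0)) = 0.
Proof. by rewrite tangent_basis /= -[0]/(mone : {cmonom nat}) eq_sym cm1_eq1. Qed.

Definition contr_r_linear (phi : H -> K^o) : {linear H2 -> H} :=
  HB.pack_for {linear H2 -> H} (contr_r phi : H2 -> H)
    (GRing.isLinear.Build K H2 H *:%R (contr_r phi : H2 -> H) (linearP (contr_r phi))).

Definition tmap_linear (F : H -> H) : {linear H2 -> H2} :=
  HB.pack_for {linear H2 -> H2} (tmap idfun F : H2 -> H2)
    (GRing.isLinear.Build K H2 H2 *:%R (tmap idfun F : H2 -> H2)
      (linearP (tmap idfun F))).

Definition vfield (j : nat) (h : H) : H := contr_r (tangent j) (Delta h).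

Lemma vfield_is_linear j : linear (vfield j).
Proof. by move=> a f g; rewrite /vfield !linearP. Qed.
HB.instance Definition _ j := GRing.isLinear.Build K H H *:%R (vfield j)
  (vfield_is_linear j).

Lemma H2_ind (P : H2 -> Prop) :
  (forall c s t, P s -> P t -> P (c *: s + t)) ->
  (forall f g : H, P (tens f g)) -> forall t, P t.
Proof.
move=> PD Pt t; have P0 : P 0.
  by have := PD (-1) _ _ (Pt 0 0) (Pt 0 0); rewrite scaleN1r addNr.
rewrite -[t]linext_id /linext; elim/big_ind: _ => // [s s' Ps Ps'|[p q] _].
  by rewrite -[s]scale1r; apply: PD.
by rewrite -tensUU -[X in P X]addr0; apply: PD.
Qed.

Lemma H_gen_ind (P : H -> Prop) :
  (forall a f g, P f -> P g -> P (a *: f + g)) -> P 1 ->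
  (forall f, P f -> P (v * f)) ->
  (forall j f, P f -> P (u j.+1 * f)) -> forall f, P f.
Proof.
by move=> PD P1 Pv Pu; apply: (fdb_alg_ind PD P1 (Pu 0%N) Pv (fun j => Pu j.+1)).
Qed.

Lemma vfield_spec :
  [/\ forall h, contr_r eps (Delta h) = h,
      forall j f g, vfield j (f * g) = vfield j f * g + f * vfield j g,
      forall j n, (0 < n)%N ->
        vfield j (u n) = 'C(n, j.+2)%:R *: u (n - j.+1)%N,
      forall j h, Delta (vfield j h) = tmap idfun (vfield j) (Delta h)
    & forall j h, vfield 0 (vfield j h) - vfield j (vfield 0 h)
        = - ((j * j.+3)%:R / 2) *: vfield j.+1 h].
Proof.
apply: (@inv_field_spec K H H2 (@tens K fdb_monom fdb_monom) K0 (@tens_linr K _ _)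
  (fun a b c d => @tensM K fdb_monom fdb_monom a c b d) _ H2_ind
  contr_r_linear _ tmap_linear _ u v H_gen_ind eps Delta counit1 (@fdb_counitM K)
  (@fdb_counitE K) counit_v (@fdb_comul1 K) (@fdb_comulM K) (@fdb_comulE K)
  (@fdb_comul_u1_inv K) tangent tangentM tangent_u _).
- by rewrite [LHS]tensUU.
- by move=> phi f g; apply: contr_r_tens.
- by move=> F f g; apply: (tmap_tens idfun F).
by move=> j; apply: tangent_laurent.
Qed.

Lemma vfield_v j : vfield j v = 0.
Proof.
apply: etrans (congr1 (contr_r (tangent j)) (@fdb_comul_u1_inv K)) _.
apply: etrans (contr_r_tens (tangent j) v v) _.
by apply: etrans (congr1 (fun a => a *: v) (tangent_laurent j _)) _; rewrite scale0r.
Qed.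

End FdBFields.

(** * Degrees and triangular families of derivations *)

(** Degrees are bounded strictly, so that bound 0 means zero and subtraction of natural
numbers in a bound never hides a negative degree. *)
Section DegLt.
Variables (K : fieldType) (M : nmodType) (w : M -> nat).
Notation A := (monoid_algebra K M).

Definition deg_lt (n : nat) (f : A) : Prop :=
  forall p, f@_p != 0 -> (w p < n)%N.

Lemma deg_lt_lin n (a : K) (f g : A) :
  deg_lt n f -> deg_lt n g -> deg_lt n (a *: f + g).
Proof.
move=> Df Dg p; rewrite mcoeffD mcoeffZ; have [->|/Df//] := eqVneq f@_p 0.
by rewrite mulr0 add0r => /Dg.
Qed.

Lemma deg_lt0 n : deg_lt n 0.
Proof. by move=> p; rewrite mcoeff0 eqxx. Qed.

Lemma deg_ltD n (f g : A) : deg_lt n f -> deg_lt n g -> deg_lt n (f + g).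
Proof. by move=> Df Dg; rewrite -[f]scale1r; apply: deg_lt_lin. Qed.

Lemma deg_ltZ n a (f : A) : deg_lt n f -> deg_lt n (a *: f).
Proof. by move=> Df; rewrite -[_ *: _]addr0; apply: deg_lt_lin => //; apply: deg_lt0. Qed.

Lemma deg_lt_sum n (I : Type) (r : seq I) (P : pred I) (F : I -> A) :
  (forall i, P i -> deg_lt n (F i)) -> deg_lt n (\sum_(i <- r | P i) F i).
Proof.
by move=> DF; elim/big_ind: _ => //; [apply: deg_lt0|move=> *; apply: deg_ltD].
Qed.

Lemma deg_ltW m n (f : A) : (m <= n)%N -> deg_lt m f -> deg_lt n f.
Proof. by move=> mn Df p /Df pm; apply: leq_trans mn. Qed.

Lemma deg_lt0P (f : A) : deg_lt 0 f <-> f = 0.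
Proof.
split=> [Df|->]; last exact: deg_lt0.
by apply/malgP => p; rewrite mcoeff0; apply/eqP; apply: contraT => /Df.
Qed.

Lemma deg_lt_basis n p : (w p < n)%N -> deg_lt n (basis K p).
Proof.
by move=> pn q; rewrite mcoeff_basis; case: (p =P q) => [<-|]; rewrite ?eqxx.
Qed.

Lemma deg_lt_linext (I : choiceType) n (h : I -> A) f :
  (forall i, f@_i != 0 -> deg_lt n (h i)) -> deg_lt n (linext h f).
Proof.
move=> Dh; rewrite /linext big_seq; apply: deg_lt_sum => i.
by rewrite -mcoeff_neq0 => /Dh; apply: deg_ltZ.
Qed.

Hypothesis wD : forall p q, w (p + q) = (w p + w q)%N.

Lemma deg_ltM m n (f g : A) :
  deg_lt m.+1 f -> deg_lt n g -> deg_lt (m + n) (f * g).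
Proof.
move=> Df Dg; rewrite -[f * g]/(ma_mul f g) /ma_mul.
apply: deg_lt_linext => p /Df pm; apply: deg_lt_linext => q /Dg qn.
by apply: deg_lt_basis; rewrite wD; lia.
Qed.

Lemma deg_lt_exp m n (f : A) : w 0 = 0%N ->
  deg_lt m.+1 f -> deg_lt (m * n).+1 (f ^+ n).
Proof.
move=> w0 Df; elim: n => [|n IH].
  by rewrite muln0 expr0; apply: deg_lt_basis; rewrite w0.
by rewrite exprS mulnS -addnS; apply: deg_ltM.
Qed.

End DegLt.

(** The degrees of x_1 (for 0) and of z_(i+1) (for [i > 0]). *)
Definition var_deg (i : nat) : nat := maxn i 1.

Definition mono_deg (p : fdb_monom) : nat :=
  (\sum_(i <- finsupp p.2) var_deg i * p.2 i)%N.

Lemma mono_degEw (p : fdb_monom) (d : {fset nat}) : (finsupp p.2 `<=` d)%fset ->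
  mono_deg p = (\sum_(i <- d) var_deg i * p.2 i)%N.
Proof.
move=> le; rewrite /mono_deg (big_fset_incl _ le) // => i _.
by rewrite -cmE_eq0 => /eqP ->; rewrite muln0.
Qed.

Lemma mono_degD (p q : fdb_monom) : mono_deg (p + q) = (mono_deg p + mono_deg q)%N.
Proof.
rewrite (@mono_degEw _ (finsupp p.2 `|` finsupp q.2)%fset); last first.
  by rewrite -[(p + q).2]/(mmul p.2 q.2) mdomD.
rewrite (@mono_degEw p _ (fsubsetUl _ (finsupp q.2))).
rewrite (@mono_degEw q _ (fsubsetUr (finsupp p.2) _)).
rewrite -big_split /=; apply: eq_bigr => i _.
by rewrite -[p.2 + q.2]/(mmul p.2 q.2) cmM mulnDr.
Qed.

Lemma mono_deg_laurent k : mono_deg (k, 0) = 0%N.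
Proof.
by rewrite /mono_deg -[(k, 0).2]/(mone : {cmonom nat}) mdom1 big_seq_fset0.
Qed.

Lemma mono_deg_var k i : mono_deg (k, ucm i) = var_deg i.
Proof. by rewrite /mono_deg /= mdomU big_seq_fset1 cmUU muln1. Qed.

Lemma leq_mono_deg (p : fdb_monom) i : (var_deg i * p.2 i <= mono_deg p)%N.
Proof.
rewrite (@mono_degEw _ (i |` finsupp p.2)%fset) ?fsubsetU1 //.
by rewrite (big_fsetD1 i) ?fset1U1 //= leq_addr.
Qed.

Lemma mono_deg_eq0 (p : fdb_monom) : mono_deg p = 0%N -> p.2 = 0.
Proof.
move=> p0; apply/eqP/cmP => i; rewrite -[0]/(mone : {cmonom nat}) cm1.
have := leq_mono_deg p i; rewrite p0 /var_deg; lia.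
Qed.

(** The monomials of [P] are read in the variables X = x, Y 0 = x_1 and
Y i = z_(i+1). *)
Section TriangularDerivations.
Variable K : fieldType.
Hypothesis K0 : [pchar K] =i pred0.
Notation P := (monoid_algebra K fdb_monom).
Notation Y i := (basis K ((0, ucm i) : fdb_monom) : P).
Notation dlt := (deg_lt mono_deg).

Variable D : nat -> {linear P -> P}.
Hypothesis DM : forall j f g, D j (f * g) = D j f * g + f * D j g.
Hypothesis DX : forall j k, D j (basis K (k, 0)) = 0.
Hypothesis DY_lt : forall j i, (i < j)%N -> D j (Y i) = 0.
Hypothesis DY_eq : forall j, D j (Y j) = 1.
Hypothesis DY_deg : forall j i, dlt (var_deg i + 1 - var_deg j) (D j (Y i)).

Lemma deriv_step_laurent j k (p : fdb_monom) :
  D j (basis K ((k, 0) + p)) = (basis K (k, 0) : P) * D j (basis K p).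
Proof. by rewrite -ma_basisM DM DX mul0r add0r. Qed.

Lemma deriv_deg_basis j p :
  dlt (mono_deg p + 1 - var_deg j) (D j (basis K p)).
Proof.
elim/fdb_monom_ind: p => [|p IH|p IH|p i IH].
- by rewrite [D j _]DX; apply: deg_lt0.
- rewrite deriv_step_laurent mono_degD mono_deg_laurent add0n -[X in dlt X]add0n.
  by apply: deg_ltM => //; [exact: mono_degD|apply: deg_lt_basis; rewrite mono_deg_laurent].
- rewrite deriv_step_laurent mono_degD mono_deg_laurent add0n -[X in dlt X]add0n.
  by apply: deg_ltM => //; [exact: mono_degD|apply: deg_lt_basis; rewrite mono_deg_laurent].
rewrite -ma_basisM DM mono_degD mono_deg_var; apply: deg_ltD.
  case: (leqP (var_deg j) (var_deg i)) => ji.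
    apply: (@deg_ltW _ _ _ ((var_deg i - var_deg j) + (mono_deg p).+1)); first by lia.
    apply: deg_ltM; [exact: mono_degD | | by apply: deg_lt_basis].
    by have := @DY_deg j i; rewrite (_ : (_ + _ - _ = (var_deg i - var_deg j).+1)%N) //; lia.
  have := @DY_deg j i; rewrite (_ : (_ + _ - _ = 0)%N); last by lia.
  by move/deg_lt0P => ->; rewrite mul0r; apply: deg_lt0.
case: (leqP (var_deg j) (mono_deg p + 1)) => ji.
  apply: (@deg_ltW _ _ _ (var_deg i + (mono_deg p + 1 - var_deg j))); first by lia.
  by apply: deg_ltM => //; [exact: mono_degD|apply: deg_lt_basis; rewrite mono_deg_var].
move: IH; rewrite (_ : (_ + _ - _ = 0)%N); last by lia.
by move/deg_lt0P => ->; rewrite mulr0; apply: deg_lt0.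
Qed.

Lemma deriv_deg j n f : dlt n f -> dlt (n - var_deg j) (D j f).
Proof.
move=> Df; rewrite -[f]linext_id linext_comp; apply: deg_lt_linext => p /Df pn /=.
by apply: deg_ltW (@deriv_deg_basis j p); lia.
Qed.

(** On the monomials that involve no variable after [Y j], the derivation [D j] is
the partial derivative with respect to [Y j]. *)
Lemma deriv_basis j (p : fdb_monom) : (forall i, (j < i)%N -> p.2 i = 0%N) ->
  D j (basis K p) = (p.2 j)%:R *: basis K ((p.1, divcm p.2 (ucm j)) : fdb_monom).
Proof.
have sX k q : D j (basis K q) = (q.2 j)%:R *: basis K ((q.1, divcm q.2 (ucm j)) : fdb_monom) ->
  D j (basis K ((k, 0) + q)) =
  (((k, 0) + q).2 j)%:R *: basis K ((((k, 0) + q).1, divcm (((k, 0) + q).2) (ucm j)) : fdb_monom).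
  move=> E; rewrite deriv_step_laurent E -scalerAr ma_basisM.
  rewrite -[((k, 0) + q).2]/(0 + q.2) add0r; congr (_ *: basis K _).
  by congr pair; rewrite add0r.
elim/fdb_monom_ind: p => [_|p IH pj|p IH pj|p i IH pj].
- by rewrite [D j _]DX /= cm1 scale0r.
- by apply: sX; apply: IH => i /pj; rewrite -[(_ + p).2]/(0 + p.2) add0r.
- by apply: sX; apply: IH => i /pj; rewrite -[(_ + p).2]/(0 + p.2) add0r.
have p2 l : ((0, ucm i) + p).2 l = ((i == l) + p.2 l)%N.
  by rewrite -[(_ + p).2]/(mmul (ucm i) p.2) cmM cmU.
have {}IH : D j (basis K p) = (p.2 j)%:R *: basis K ((p.1, divcm p.2 (ucm j)) : fdb_monom).
  by apply: IH => l /pj; rewrite p2; lia.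
rewrite -ma_basisM DM IH p2.
case: (ltngtP i j) => [ij|ji|ij].
- rewrite DY_lt // mul0r !add0r -scalerAr ma_basisM.
  case: (posnP (p.2 j)) => [->|pj0]; first by rewrite !scale0r.
  congr (_ *: basis K _).
  rewrite [LHS](_ : _ = (0 + p.1, ucm i + divcm p.2 (ucm j))) //.
  by rewrite ucm_divA // ltn_eqF.
- by have := pj i ji; rewrite p2 eqxx.
rewrite ij DY_eq mul1r -scalerAr ma_basisM natrD scalerDl scale1r.
rewrite -[((0, ucm j) + p).2]/(ucm j + p.2) ucm_addK.
rewrite (_ : (((0, ucm j) + p).1, p.2) = p); last by rewrite /= add0r; case: (p).
congr (_ + _); case: (posnP (p.2 j)) => [->|pj0]; first by rewrite !scale0r.
congr (_ *: basis K _); rewrite [LHS](_ : _ = (0 + p.1, ucm j + divcm p.2 (ucm j))) //.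
by rewrite ucm_divK // add0r; case: (p).
Qed.

(** Take in [h] a monomial [q] of top degree [d] whose last variable [Y j] comes as
late as possible, and let [r] be [q] with one [Y j] removed. Monomials of lower
degree contribute to [D j h] in degree less than that of [r], and [D j] acts on
those of degree [d] as a partial derivative; so [r] occurs in [D j h] with the
coefficient of [q] times the exponent of [Y j], which is not 0. *)
Lemma deriv_criterion n h :
  (forall j, dlt (n.+1 - var_deg j) (D j h)) -> dlt n.+1 h.
Proof.
move=> Dh p hp; rewrite ltnNge; apply/negP => np.
pose T d := has (fun q : fdb_monom => mono_deg q == d) (msupp h).
have TP d : reflect (exists2 q, h@_q != 0 & mono_deg q = d) (T d).
  apply: (iffP hasP) => [[q qh /eqP qd]|[q qh qd]]; exists q; rewrite ?qd //.
    by rewrite mcoeff_neq0.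
  by rewrite -mcoeff_neq0.
have exT : exists d, T d by exists (mono_deg p); apply/TP; exists p.
have ubT d : T d -> (d <= \max_(q <- msupp h) mono_deg q)%N.
  by case/TP => q qh <-; apply: leq_bigmax_seq; rewrite -?mcoeff_neq0.
have [d /TP[q0 q0h q0d] dmax] := ex_maxnP exT ubT.
have le_d q : h@_q != 0 -> (mono_deg q <= d)%N.
  by move=> qh; apply: dmax; apply/TP; exists q.
have nd : (n < d)%N by apply: leq_trans (le_d p hp).
pose Q j := has (fun q : fdb_monom => (mono_deg q == d) && (0 < q.2 j)%N) (msupp h).
have QP j : reflect (exists q : fdb_monom, [/\ h@_q != 0, mono_deg q = d & (0 < q.2 j)%N]) (Q j).
  apply: (iffP hasP) => [[q qh /andP[/eqP qd qj]]|[q [qh qd qj]]].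
    by exists q; rewrite mcoeff_neq0.
  by exists q; rewrite -?mcoeff_neq0 // qd eqxx.
have exQ : exists j, Q j.
  have q0_neq0 : q0.2 <> 0.
    move=> E; move: nd; rewrite -q0d (_ : q0 = (q0.1, 0)) ?mono_deg_laurent //.
    by rewrite -E; case: (q0).
  have [j qj] : exists j, (0 < q0.2 j)%N.
    case: (finsupp q0.2 =P fset0) => [m0|/eqP/fset0Pn[j jm]]; last first.
      by exists j; rewrite lt0n cmE_neq0.
    by case: q0_neq0; apply: mdeg_eq0I; rewrite mdegE m0 big_seq_fset0.
  by exists j; apply/QP; exists q0.
have ubQ j : Q j -> (j <= d)%N.
  by case/QP => q [_ qd qj]; have := leq_mono_deg q j; rewrite qd /var_deg; nia.
have [j /QP [q [qh qd qj]] jmax] := ex_maxnP exQ ubQ.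
have top r : h@_r != 0 -> mono_deg r = d -> forall i, (j < i)%N -> r.2 i = 0%N.
  move=> rh rd i ji; case: (posnP (r.2 i)) => // ri.
  by have := jmax i; rewrite (introT (QP i)); [lia|exists r].
pose r : fdb_monom := (q.1, divcm q.2 (ucm j)).
have qE : q = (0%Z, ucm j) + r.
  rewrite [RHS](_ : _ = (0 + q.1, ucm j + divcm q.2 (ucm j))) //.
  by rewrite ucm_divK // add0r; case: (q).
have rd : (mono_deg r + var_deg j = d)%N.
  by rewrite -qd qE mono_degD mono_deg_var addnC.
have : (D j h)@_r != 0.
  have -> : (D j h)@_r = h@_q * (q.2 j)%:R.
    have -> : (D j h)@_r = \sum_(s <- msupp h) h@_s * (D j (basis K s))@_r.
      rewrite -{1}[h]linext_id linext_comp /linext raddf_sum.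
      by apply: eq_bigr => s _; exact: mcoeffZ.
    rewrite (bigD1_seq q) -?mcoeff_neq0 ?fset_uniq //= [X in _ + X]big1_seq ?addr0.
      rewrite deriv_basis; last exact: top.
      by rewrite mcoeffZ mcoeff_basis eqxx mulr1.
    move=> s /andP[sq]; rewrite -mcoeff_neq0 => sh.
    have [sd|sd] := eqVneq (mono_deg s) d.
      rewrite deriv_basis; last exact: top.
      rewrite mcoeffZ mcoeff_basis; case: eqP => [E|]; last by rewrite !mulr0.
      case: (posnP (s.2 j)) => [->|sj]; first by rewrite mul0r mulr0.
      case/eqP: sq; rewrite qE -E [RHS](_ : _ = (0 + s.1, ucm j + divcm s.2 (ucm j))) //.
      by rewrite ucm_divK // add0r; case: (s).
    suff -> : (D j (basis K s))@_r = 0 by rewrite mulr0.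
    apply/eqP; apply: contraT => /(@deriv_deg_basis j s); have := le_d s sh; lia.
  by rewrite mulf_neq0 // pchar0_natr_neq0.
by move/(Dh j); lia.
Qed.

End TriangularDerivations.

(** * The filtration in the coordinates x, x_1, z_2, z_3, ... *)

(** [Phi] writes an element in the variables of [P] and [Psi] evaluates it back. *)
Section Coordinates.
Variables (K : fieldType) (H : comAlgType K) (u : nat -> H) (v : H).
Hypothesis K0 : [pchar K] =i pred0.
Hypothesis uv : u 1%N * v = 1.
Notation P := (monoid_algebra K fdb_monom).
Notation Y i := (basis K ((0, ucm i) : fdb_monom) : P).
Notation X k := (basis K ((k, 0) : fdb_monom) : P).
Notation x m := (u m.+1 * v).
Notation zcoef n := ((n.+1)`!%:R / 2 ^+ n : K).
Notation z n := (x n - zcoef n *: x 1%N ^+ n).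

Variables (Phi : {linear H -> P}) (Psi : {linear P -> H}).
Hypothesis PhiK : cancel Phi Psi.
Hypothesis PsiK : cancel Psi Phi.
Hypothesis PhiM : {morph Phi : f g / f * g}.
Hypothesis PsiM : {morph Psi : f g / f * g}.
Hypothesis Phi1 : Phi 1 = 1.
Hypothesis Psi_X : Psi (X 1) = u 1%N.
Hypothesis Psi_XV : Psi (X (-1)) = v.
Hypothesis Psi_Y : forall i, Psi (Y i) = if i is 0 then x 1%N else z i.+1.

Variable D : nat -> {linear H -> H}.
Hypothesis DM : forall j f g, D j (f * g) = D j f * g + f * D j g.
Hypothesis Du : forall j n, (0 < n)%N ->
  D j (u n) = 'C(n, j.+2)%:R *: u (n - j.+1)%N.
Hypothesis Dv : forall j, D j v = 0.
Hypothesis Dbr : forall j h, D 0 (D j h) - D j (D 0 h)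
  = - ((j * j.+3)%:R / 2) *: D j.+1 h.

Definition filt (n : nat) (h : H) : Prop := deg_lt mono_deg n (Phi h).

Lemma deriv_one j : D j 1 = 0.
Proof.
have := DM j 1 1; rewrite !mulr1 mul1r => E.
by apply: (addrI (D j 1)); rewrite addr0 -E.
Qed.

Lemma D_x j n : D j (x n) = 'C(n.+1, j.+2)%:R *: (u (n - j)%N * v).
Proof. by rewrite DM Dv mulr0 addr0 Du // subSS scalerAl. Qed.

Lemma Dexp j f n : D j (f ^+ n) = f ^+ n.-1 * D j f *+ n.
Proof.
elim: n => [|n IH]; first by rewrite expr0 deriv_one mulr0n.
rewrite exprS DM IH mulrC mulrS; congr (_ + _).
case: n {IH} => [|n]; first by rewrite !mulr0n mulr0.
by rewrite mulrnAr mulrA -exprS.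
Qed.

Lemma pchar0_two_neq0 : 2 != 0 :> K.
Proof. exact: (@pchar0_natr_neq0 K K0 2). Qed.

Lemma zcoef1 : zcoef 1%N = 1.
Proof. by rewrite expr1 divff ?pchar0_two_neq0. Qed.

Lemma zcoefS n : 'C(n.+2, 2)%:R * zcoef n = n.+1%:R * zcoef n.+1.
Proof.
have E : 'C(n.+2, 2)%:R = n.+2%:R * n.+1%:R / 2 :> K.
  apply: (canRL (mulfK pchar0_two_neq0)); rewrite -!natrM; congr (_%:R).
  by rewrite mulnC mul_bin_left bin1 subn1 mulnC.
rewrite E [n.+2`!]factS (natrM K n.+2) exprS.
have := pchar0_two_neq0; have : 2 ^+ n != 0 :> K by rewrite expf_neq0 ?pchar0_two_neq0.
move: (2 ^+ n) (n.+1`!%:R) (n.+1%:R) (n.+2%:R) => a b c d a0 t0.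
by field; rewrite a0.
Qed.

Lemma D0_x1 : D 0 (x 1%N) = 1.
Proof. by rewrite D_x subn0 scale1r uv. Qed.

Lemma DS_x1 j : D j.+1 (x 1%N) = 0.
Proof. by rewrite D_x scale0r. Qed.

(** For [n = 1] the right-hand side is 0: this is what makes z_2 of degree 1
and lets [D 0] lower the degree. *)
Lemma D0_z n : D 0 (z n.+1) = 'C(n.+2, 2)%:R *: z n.
Proof.
rewrite linearB linearZ /= D_x subn0 Dexp D0_x1 mulr1 /=.
rewrite scalerBr scalerA zcoefS -[_ *+ n.+1]scaler_nat scalerA.
by rewrite [n.+1%:R * _]mulrC.
Qed.

Lemma DS_z j n : D j.+1 (z n) = 'C(n.+1, j.+3)%:R *: (u (n - j.+1)%N * v).
Proof. by rewrite linearB linearZ /= Dexp DS_x1 mulr0 mul0rn scaler0 subr0 D_x. Qed.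

Lemma filt_lin n (a : K) f g : filt n f -> filt n g -> filt n (a *: f + g).
Proof. by rewrite /filt linearP; apply: deg_lt_lin. Qed.

Lemma filt_z i : filt (i.+1).+1 (z i.+2).
Proof.
have E : Psi (Y i.+1) = z i.+2 by rewrite Psi_Y.
rewrite /filt -E PsiK; apply: deg_lt_basis.
by rewrite mono_deg_var /var_deg; lia.
Qed.

Lemma filt_x1 : filt 2 (x 1%N).
Proof.
have E : Psi (Y 0) = x 1%N by rewrite Psi_Y.
by rewrite /filt -E PsiK; apply: deg_lt_basis; rewrite mono_deg_var.
Qed.

Lemma Phi_exp f n : Phi (f ^+ n) = Phi f ^+ n.
Proof. by elim: n => [|n IH]; rewrite ?expr0 // !exprS PhiM IH. Qed.

Lemma filt_x m : filt m.+1 (x m).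
Proof.
case: m => [|m].
  by rewrite /filt uv Phi1; apply: deg_lt_basis; rewrite mono_deg_laurent.
case: m => [|m]; first exact: filt_x1.
rewrite (_ : x m.+2 = zcoef m.+2 *: x 1%N ^+ m.+2 + z m.+2); last first.
  by rewrite addrC subrK.
apply: filt_lin; last by apply: (deg_ltW _ (@filt_z m)); lia.
rewrite /filt Phi_exp -{1}[m.+2]mul1n; apply: deg_lt_exp; last exact: filt_x1.
  exact: mono_degD.
exact: mono_deg_laurent.
Qed.

Definition coordD (j : nat) : {linear P -> P} := Phi \o D j \o Psi.

Lemma coordDM j f g : coordD j (f * g) = coordD j f * g + f * coordD j g.
Proof. by rewrite /= PsiM DM linearD !PhiM !PsiK. Qed.

Lemma coordDX j k : coordD j (X k) = 0.
Proof.
have DX0 : coordD j (X 0) = 0.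
  by rewrite -[X 0]/(1 : P) -Phi1 /= PhiK deriv_one linear0.
have XD a b : X (a + b) = X a * X b by rewrite ma_basisM; congr (basis K (_, _)); rewrite addr0.
elim/int_rect: k => [//|n IH|n IH].
  by rewrite -addn1 PoszD XD coordDM IH mul0r add0r /= Psi_X Du // scale0r linear0 mulr0.
by rewrite -addn1 PoszD opprD XD coordDM IH mul0r add0r /= Psi_XV Dv linear0 mulr0.
Qed.

Lemma coordDY_lt j i : (i < j)%N -> coordD j (Y i) = 0.
Proof.
case: j => // j ij; rewrite /= Psi_Y; case: i ij => [|i] ij.
  by rewrite DS_x1 linear0.
by rewrite DS_z bin_small ?scale0r ?linear0 //; lia.
Qed.

Lemma coordDY_eq j : coordD j (Y j) = 1.
Proof.
rewrite /= Psi_Y; case: j => [|j]; first by rewrite D0_x1 Phi1.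
by rewrite DS_z binn subSnn uv scale1r Phi1.
Qed.

Lemma coordDY_deg j i : deg_lt mono_deg (var_deg i + 1 - var_deg j) (coordD j (Y i)).
Proof.
case: (ltngtP i j) => [ij|ji|->].
- by rewrite coordDY_lt //; apply: deg_lt0.
- case: i ji => // i ji; rewrite [coordD _ _]/= Psi_Y; case: j ji => [|j] ji; last first.
    rewrite DS_z linearZ; apply: deg_ltZ.
    have -> : (i.+2 - j.+1 = (i - j).+1)%N by lia.
    by apply: (deg_ltW _ (@filt_x (i - j)%N)); rewrite /var_deg; lia.
  rewrite D0_z linearZ; apply: deg_ltZ; case: i ji => [|i] ji; last first.
    by apply: (deg_ltW _ (@filt_z i)); rewrite /var_deg; lia.
  by rewrite zcoef1 scale1r expr1 subrr linear0; apply: deg_lt0.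
rewrite coordDY_eq; apply: deg_lt_basis; rewrite mono_deg_laurent; lia.
Qed.

Lemma filt_D j n h : filt n h -> filt (n - var_deg j) (D j h).
Proof.
move=> Dh; rewrite /filt -{1}[h]PhiK.
exact: (@deriv_deg K coordD coordDM coordDX coordDY_deg j n (Phi h) Dh).
Qed.

Lemma filt_criterion n h :
  (forall j, filt (n.+1 - var_deg j) (D j h)) -> filt n.+1 h.
Proof.
move=> Dh; apply: (deriv_criterion K0 coordDM coordDX coordDY_lt coordDY_eq coordDY_deg) => j.
by rewrite /= PhiK; apply: Dh.
Qed.

(** The hypotheses bound the degrees of all [D j h]: the bracket of [D 0] and
[D j.+1] is a nonzero multiple of [D j.+2], and each bracket lowers the degree
by one. *)
Lemma filt_two n h : filt n (D 0 h) -> filt n (D 1 h) -> filt n.+1 h.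
Proof.
move=> h0 h1; apply: filt_criterion; case=> [|j].
  by rewrite subSS subn0.
elim: j => [|j IH]; first by rewrite subSS subn0.
pose c : K := - ((j.+1 * j.+4)%:R / 2).
have c0 : c != 0.
  by rewrite oppr_eq0 mulf_neq0 ?invr_eq0 ?pchar0_two_neq0 // pchar0_natr_neq0.
have -> : D j.+2 h = c^-1 *: (D 0 (D j.+1 h) - D j.+1 (D 0 h)).
  by rewrite Dbr -/c scalerA mulVf // scale1r.
rewrite -[_ *: _]addr0; apply: filt_lin; last by rewrite /filt linear0; apply: deg_lt0.
rewrite -scaleN1r addrC; apply: filt_lin.
  by apply: (deg_ltW _ (@filt_D j.+1 _ _ h0)); rewrite /var_deg; lia.
by apply: (deg_ltW _ (@filt_D 0 _ _ IH)); rewrite /var_deg; lia.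
Qed.

Variables (H2 : comAlgType K) (tn : H -> H -> H2).
Hypothesis tn_linl : forall g, linear (tn^~ g).
Hypothesis tn_linr : forall f, linear (tn f).
Hypothesis tnM : forall a b c d, tn (a * c) (b * d) = tn a b * tn c d.
Hypothesis tn11 : tn 1 1 = 1.
Hypothesis tn_ind : forall Q : H2 -> Prop,
  (forall c s t, Q s -> Q t -> Q (c *: s + t)) ->
  (forall f g, Q (tn f g)) -> forall t, Q t.
Variable (Delta : {linear H -> H2}).
Hypothesis Delta1 : Delta 1 = 1.
Hypothesis DeltaM : {morph Delta : x y / x * y}.
Hypothesis Delta_u : forall n, (0 < n)%N ->
  Delta (u n) = \sum_(1 <= k < n.+1) tn (u k) (bell n k u).
Hypothesis Delta_v : Delta v = tn v v.
Variables (sl : fdb_monom -> {linear H2 -> H}).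
Hypothesis sl_tn : forall m f g, sl m (tn f g) = (Phi f)@_m *: g.
Hypothesis sl_Delta_D : forall m j h, sl m (Delta (D j h)) = D j (sl m (Delta h)).
Variable eps : {linear H -> K^o}.
Hypothesis coef_eps : forall m h, (Phi h)@_m = eps (sl m (Delta h)).

(** The elements of H # H whose left factors have degree less than [n]. *)
Definition lfilt (n : nat) : H2 -> Prop :=
  Defs.span (fun t => exists2 f, filt n f & exists g, t = tn f g).

Lemma lfilt_lin n (a : K) s t : lfilt n s -> lfilt n t -> lfilt n (a *: s + t).
Proof. exact: span_lin. Qed.

Lemma lfilt_tn n f g : filt n f -> lfilt n (tn f g).
Proof. by move=> nf; apply: span_in; exists f => //; exists g. Qed.

Lemma lfilt0 n : lfilt n 0.
Proof. exact: span0. Qed.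

Lemma lfiltD n s t : lfilt n s -> lfilt n t -> lfilt n (s + t).
Proof. by move=> ns nt; rewrite -[s]scale1r; apply: lfilt_lin. Qed.

Lemma lfiltZ n a s : lfilt n s -> lfilt n (a *: s).
Proof. by move=> ns; rewrite -[_ *: _]addr0; apply: lfilt_lin => //; apply: lfilt0. Qed.

Lemma lfiltW m n t : (m <= n)%N -> lfilt m t -> lfilt n t.
Proof.
move=> mn; apply: span_ind => [|a s s' ns ns'|_ [f nf [g ->]]].
- exact: lfilt0.
- exact: lfilt_lin.
by apply: lfilt_tn; apply: (deg_ltW mn nf).
Qed.

Lemma lfiltM m n s t : lfilt m.+1 s -> lfilt n t -> lfilt (m + n) (s * t).
Proof.
move=> ms nt; move: s ms; apply: span_ind => [|a s s' ns ns'|_ [f nf [g ->]]].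
- by rewrite mul0r; apply: lfilt0.
- by rewrite mulrDl -scalerAl; apply: lfilt_lin.
move: t nt; apply: span_ind => [|a t t' nt nt'|_ [f' nf' [g' ->]]].
- by rewrite mulr0; apply: lfilt0.
- by rewrite mulrDr -scalerAr; apply: lfilt_lin.
rewrite -tnM; apply: lfilt_tn; rewrite /filt PhiM.
by apply: deg_ltM => //; apply: mono_degD.
Qed.

Lemma lfilt_sl n t : lfilt n t ->
  forall m, (n <= mono_deg m)%N -> sl m t = 0.
Proof.
move=> nt m nm; move: t nt; apply: span_ind => [|a s s' ns ns'|_ [f nf [g ->]]].
- by rewrite linear0.
- by rewrite linearP ns ns' scaler0 addr0.
rewrite sl_tn; have [->|/nf] := eqVneq (Phi f)@_m 0; first by rewrite scale0r.
by lia.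
Qed.

Lemma Delta_x m : Delta (x m) =
  \sum_(0 <= k < m.+1) tn (x k) (bell m.+1 k.+1 u * v).
Proof.
rewrite DeltaM Delta_u // Delta_v big_add1 /= mulr_suml.
by apply: eq_bigr => k _; rewrite -tnM.
Qed.

Lemma u1_bell_diag m : bell m.+1 m.+1 u * v = u 1%N ^+ m.
Proof. by rewrite (bell_diag K0) exprSr -mulrA uv mulr1. Qed.

(** In Delta x_m the left factors x_k have degree k, so only the last term is of
degree m on the left. *)
Lemma Delta_x_top m :
  lfilt m (Delta (x m) - tn (x m) (u 1%N ^+ m)).
Proof.
rewrite Delta_x big_nat_recr //= u1_bell_diag addrK big_nat.
elim/big_ind: _ => [||k /andP[_ km]]; [exact: lfilt0|exact: lfiltD|].
by apply: lfilt_tn; apply: (deg_ltW km (@filt_x k)).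
Qed.

Lemma filt_exp_x1 n : filt n.+1 (x 1%N ^+ n).
Proof.
rewrite /filt Phi_exp -{1}[n]mul1n; apply: deg_lt_exp; last exact: filt_x1.
  exact: mono_degD.
exact: mono_deg_laurent.
Qed.

Lemma tn_exp f g n : tn f g ^+ n = tn (f ^+ n) (g ^+ n).
Proof. by elim: n => [|n IH]; rewrite ?expr0 ?tn11 // !exprS IH tnM. Qed.

Lemma Delta_x1_exp_top n :
  lfilt n (Delta (x 1%N) ^+ n - tn (x 1%N ^+ n) (u 1%N ^+ n)).
Proof.
elim: n => [|n IH]; first by rewrite !expr0 tn11 subrr; apply: lfilt0.
pose b := tn (x 1%N) (u 1%N); pose a := Delta (x 1%N) - b.
have a1 : lfilt 1 a by exact: (Delta_x_top 1).
have dE : Delta (x 1%N) = a + b by rewrite subrK.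
have b2 : lfilt 2 b by apply: lfilt_tn; apply: filt_x1.
have bE k : tn (x 1%N ^+ k) (u 1%N ^+ k) = b ^+ k by rewrite tn_exp.
rewrite bE in IH; rewrite bE.
have -> : Delta (x 1%N) ^+ n.+1 - b ^+ n.+1 =
    Delta (x 1%N) * (Delta (x 1%N) ^+ n - b ^+ n) + a * b ^+ n.
  rewrite !exprS mulrBr [T in _ = _ - T + _](_ : _ = a * b ^+ n + b * b ^+ n).
    by rewrite opprD addrA addrAC subrK.
  by rewrite {1}dE mulrDl.
apply: lfiltD.
  by rewrite -add1n; apply: lfiltM => //; rewrite dE; apply: lfiltD => //; apply: lfiltW a1.
rewrite -[n.+1]add0n; apply: lfiltM => //.
by rewrite -bE; apply: lfilt_tn; apply: filt_exp_x1.
Qed.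

(** Delta x_n and Delta (x_1)^n have leading terms x_n # x^n and x_1^n # x^n on the
left, which combine into z_n # x^n, where z_n has degree n - 1. *)
Lemma Delta_z n : lfilt n.+2 (Delta (z n.+2)).
Proof.
rewrite linearB linearZ /=.
have -> : Delta (x 1%N ^+ n.+2) = Delta (x 1%N) ^+ n.+2.
  by elim: n.+2 => [|k IH]; rewrite ?expr0 // !exprS DeltaM IH.
pose g := u 1%N ^+ n.+2; pose A := Delta (x n.+2) - tn (x n.+2) g.
pose B := Delta (x 1%N) ^+ n.+2 - tn (x 1%N ^+ n.+2) g.
have -> : Delta (x n.+2) - zcoef n.+2 *: Delta (x 1%N) ^+ n.+2 =
  (- zcoef n.+2) *: B + A + tn (z n.+2) g.
  rewrite (_ : tn (z n.+2) g = (- zcoef n.+2) *: tn (x 1%N ^+ n.+2) g + tn (x n.+2) g); last first.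
    by rewrite -tn_linl scaleNr addrC.
  rewrite addrACA -scalerDr subrK subrK addrC scaleNr //.
apply: lfiltD; last by apply: lfilt_tn; apply: (deg_ltW _ (@filt_z n)).
by apply: lfilt_lin; [apply: Delta_x1_exp_top|apply: Delta_x_top].
Qed.

Lemma Delta_Psi_basis p : lfilt (mono_deg p).+1 (Delta (Psi (basis K p))).
Proof.
have X0 k : lfilt 1 (Delta (Psi (X k))) -> forall p,
    lfilt (mono_deg p).+1 (Delta (Psi (basis K p))) ->
    lfilt (mono_deg ((k, 0) + p)).+1 (Delta (Psi (basis K ((k, 0) + p)))).
  move=> Xk q IH; rewrite mono_degD mono_deg_laurent add0n -ma_basisM PsiM DeltaM.
  by rewrite -[(_).+1]add0n; apply: lfiltM.
elim/fdb_monom_ind: p => [|p IH|p IH|p i IH].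
- have -> : basis K (0 : fdb_monom) = Phi 1 by rewrite Phi1.
  rewrite PhiK Delta1 -tn11; apply: lfilt_tn; rewrite /filt Phi1.
  by apply: deg_lt_basis; rewrite mono_deg_laurent.
- apply: X0 => //; rewrite Psi_X Delta_u // big_nat1; apply: lfilt_tn.
  by rewrite /filt -Psi_X PsiK; apply: deg_lt_basis; rewrite mono_deg_laurent.
- apply: X0 => //; rewrite Psi_XV Delta_v; apply: lfilt_tn.
  by rewrite /filt -Psi_XV PsiK; apply: deg_lt_basis; rewrite mono_deg_laurent.
rewrite mono_degD mono_deg_var -ma_basisM PsiM DeltaM -addnS; apply: lfiltM => //.
rewrite Psi_Y; case: i => [|i]; last exact: Delta_z.
rewrite -[Delta _](subrK (tn (x 1%N) (u 1%N ^+ 1))); apply: lfiltD.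
  by apply: lfiltW (Delta_x_top 1).
by apply: lfilt_tn; apply: filt_x1.
Qed.

Lemma Delta_lfilt n h : filt n h -> lfilt n (Delta h).
Proof.
move=> nh; rewrite -[h]PhiK -[Phi h]linext_id !linext_comp /linext big_seq.
elim/big_ind: _ => [||p]; [exact: lfilt0|exact: lfiltD|].
rewrite -mcoeff_neq0 => /nh pn; apply: lfiltZ.
by apply: (lfiltW pn); apply: Delta_Psi_basis.
Qed.

(** Induction on [n] by [filt_two]: the components of [D j h] are [D j] of those of
[h]. The truncated subtraction is harmless because components at monomials of
degree at least [n] vanish. *)
Lemma filt_sl n h m : filt n h -> filt (n - mono_deg m) (sl m (Delta h)).
Proof.
elim: n h => [|n IH] h nh.
  by move/deg_lt0P: nh => h0; rewrite -[h]PhiK h0 !linear0 /filt linear0; apply: deg_lt0.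
case: (leqP n.+1 (mono_deg m)) => nm.
  by rewrite (lfilt_sl (Delta_lfilt nh) nm) /filt linear0; apply: deg_lt0.
rewrite subSn //; apply: filt_two; rewrite -sl_Delta_D; apply: IH.
  by have := @filt_D 0 _ _ nh; rewrite /var_deg subSS subn0.
by have := @filt_D 1 _ _ nh; rewrite /var_deg subSS subn0.
Qed.

(** The components of [D j h] are [D j] of those of [h], so the hypothesis passes to
[D 0 h] and [D 1 h] with [n] decreased. For [n = 0] the counit recovers the
coordinates of [h] from the components, which vanish in positive degree. *)
Lemma filt_of_sl n h :
  (forall m, (0 < mono_deg m)%N -> filt n (sl m (Delta h))) -> filt n.+1 h.
Proof.
elim: n h => [|n IH] h nh.
  move=> m hm; rewrite ltnS leqn0 -[_ == _]negbK -lt0n; apply/negP => m0.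
  move: hm; rewrite coef_eps; have /deg_lt0P := nh m m0.
  by move/(congr1 Psi); rewrite PhiK !linear0 => ->; rewrite linear0 eqxx.
have Dn j : (j < 2)%N -> filt n.+1 (D j h).
  move=> j2; apply: IH => m m0; rewrite sl_Delta_D.
  have := @filt_D j _ _ (nh m m0).
  by rewrite (_ : (n.+1 - var_deg j)%N = n) //; case: j j2 => [|[|]] //; rewrite /var_deg; lia.
by apply: filt_two; apply: Dn.
Qed.

Lemma tn_decomp t : exists d : {fset fdb_monom},
  (forall m, m \notin d -> sl m t = 0) /\
  t = \sum_(m <- d) tn (Psi (basis K m)) (sl m t).
Proof.
have tn0 f : tn f 0 = 0.
  by have := tn_linr f (-1) 0 0; rewrite scaleN1r addNr scaleN1r addNr.
have tn0l g : tn 0 g = 0.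
  by have := tn_linl g (-1) 0 0; rewrite scaleN1r addNr scaleN1r addNr.
have ext (d d' : {fset fdb_monom}) s : (forall m, m \notin d -> sl m s = 0) ->
    (d `<=` d')%fset ->
    \sum_(m <- d') tn (Psi (basis K m)) (sl m s)
      = \sum_(m <- d) tn (Psi (basis K m)) (sl m s).
  by move=> ds le; rewrite (big_fset_incl _ le) // => m _ /ds ->; rewrite tn0.
move: t; apply: tn_ind => [c s t [d [ds sE]] [d' [dt tE]]|f g].
  exists (d `|` d')%fset; split=> [m|].
    by rewrite in_fsetU negb_or linearP => /andP[/ds-> /dt->]; rewrite scaler0 addr0.
  have -> : \sum_(m <- (d `|` d')%fset) tn (Psi (basis K m)) (sl m (c *: s + t))
    = \sum_(m <- (d `|` d')%fset) (c *: tn (Psi (basis K m)) (sl m s)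
        + tn (Psi (basis K m)) (sl m t)).
    by apply: eq_bigr => m _; rewrite linearP tn_linr.
  rewrite big_split /= -scaler_sumr (ext d _ s) ?fsubsetUl //.
  by rewrite (ext d' _ t) ?fsubsetUr // -sE -tE.
exists (msupp (Phi f)); split=> [m|].
  by rewrite sl_tn => /mcoeff_outdom ->; rewrite scale0r.
transitivity (tn (Psi (Phi f)) g); first by rewrite PhiK.
rewrite -{1}[Phi f]linext_id linext_comp /linext.
elim/big_ind2: _ => [|a b a' b' <- <-|m _].
- by rewrite tn0l.
- by have := tn_linl g 1 b b'; rewrite !scale1r.
rewrite sl_tn -[tn _ g]addr0 -(tn0l g) -[_ *: _]addr0 tn_linl.
have := tn_linr (Psi (basis K m)) (Phi f)@_m g 0; rewrite !tn0 !addr0 => ->.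
by rewrite tn0l !addr0.
Qed.

Lemma filt_spec :
  [/\ forall j n h, filt n h -> filt (n - var_deg j) (D j h),
      forall n h, filt n (D 0 h) -> filt n (D 1 h) -> filt n.+1 h,
      forall n h m, filt n h -> filt (n - mono_deg m) (sl m (Delta h)),
      forall n h, (forall m, (0 < mono_deg m)%N -> filt n (sl m (Delta h))) ->
        filt n.+1 h
    & forall t, exists d : {fset fdb_monom},
        t = \sum_(m <- d) tn (Psi (basis K m)) (sl m t)].
Proof.
split=> [j n h|n h|n h m|n h|t]; [exact: filt_D | exact: filt_two
  | exact: filt_sl | exact: filt_of_sl |].
by have [d [_ tE]] := tn_decomp t; exists d.
Qed.

End Coordinates.

(** * The adapted coordinates on H_FdB *)

Section AdaptedCoordinates.
Variable K : fieldType.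
Hypothesis K0 : [pchar K] =i pred0.
Notation H := (HFdB K).
Notation H2 := (HFdB2 K).
Notation u := (fdb_u K).
Notation v := (fdb_u1_inv K).
Notation eps := (@fdb_counit K).
Notation Delta := (@fdb_comul K).
Notation zcoef n := ((n.+1)`!%:R / 2 ^+ n : K).

(** The polynomial algebra of the coordinates is H_FdB itself: u_1 serves as x, u_2 as
x_1, and u_(i+2) as z_(i+1). In these terms [zvar i] is the value of the [i]-th
coordinate, and [zvar_expansion i] is u_(i+2) written in coordinates. *)
Definition zvar (i : nat) : H :=
  if i is 0 then fdb_x K 1 else fdb_z K i.+1.

Definition zvar_expansion (i : nat) : H :=
  (if i is 0 then u 2 else u i.+2 + zcoef i.+1 *: u 2 ^+ i.+1) * u 1.

Definition zcoord : H -> H := fdb_eval (u 1) v zvar_expansion.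
Definition zcoord_inv : H -> H := fdb_eval (u 1) v zvar.

HB.instance Definition _ := GRing.Linear.on zcoord.
HB.instance Definition _ := GRing.Linear.on zcoord_inv.

Lemma zcoordM : {morph zcoord : f g / f * g}.
Proof. exact: fdb_evalM (fdb_u1V K) _. Qed.

Lemma zcoord_invM : {morph zcoord_inv : f g / f * g}.
Proof. exact: fdb_evalM (fdb_u1V K) _. Qed.

Lemma zcoord1 : zcoord 1 = 1.
Proof. exact: fdb_eval1. Qed.

Lemma zcoord_inv1 : zcoord_inv 1 = 1.
Proof. exact: fdb_eval1. Qed.

Lemma morph_exp (L : H -> H) : L 1 = 1 -> {morph L : f g / f * g} ->
  forall f n, L (f ^+ n) = L f ^+ n.
Proof. by move=> L1 LM f; elim=> [|n IH]; rewrite ?expr0 // !exprS LM IH. Qed.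

Lemma u1V_mulr (f : H) : f * u 1 * v = f.
Proof. by rewrite -mulrA fdb_u1V mulr1. Qed.

Lemma u1V_mull (f : H) : f * v * u 1 = f.
Proof. by rewrite -mulrA [v * _]mulrC fdb_u1V mulr1. Qed.

Lemma alg_endo_id (L : {linear H -> H}) : L 1 = 1 -> {morph L : f g / f * g} ->
  L (u 1) = u 1 -> L v = v -> (forall j, L (u j.+2) = u j.+2) -> L =1 id.
Proof.
move=> L1 LM Lu Lv Lj; apply: fdb_alg_ind => [a f g Hf Hg||f Hf|f Hf|j f Hf].
- by rewrite linearP Hf Hg.
- exact: L1.
- by rewrite LM Lu Hf.
- by rewrite LM Lv Hf.
- by rewrite LM Lj Hf.
Qed.

Lemma zcoord_u1 : zcoord (u 1) = u 1. Proof. exact: fdb_eval_u1. Qed.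
Lemma zcoord_v : zcoord v = v. Proof. exact: fdb_eval_u1i. Qed.
Lemma zcoord_uS j : zcoord (u j.+2) = zvar_expansion j. Proof. exact: fdb_eval_uS. Qed.
Lemma zcoord_inv_u1 : zcoord_inv (u 1) = u 1. Proof. exact: fdb_eval_u1. Qed.
Lemma zcoord_inv_v : zcoord_inv v = v. Proof. exact: fdb_eval_u1i. Qed.
Lemma zcoord_inv_uS j : zcoord_inv (u j.+2) = zvar j. Proof. exact: fdb_eval_uS. Qed.

Lemma zcoordK : cancel zcoord zcoord_inv.
Proof.
move=> h; apply: (alg_endo_id (L := zcoord_inv \o zcoord)) => [|f g|||j].
- by rewrite /= zcoord1 zcoord_inv1.
- exact: etrans (congr1 zcoord_inv (zcoordM f g)) (zcoord_invM _ _).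
- by rewrite -[LHS]/(zcoord_inv (zcoord _)) zcoord_u1 zcoord_inv_u1.
- by rewrite -[LHS]/(zcoord_inv (zcoord _)) zcoord_v zcoord_inv_v.
rewrite -[LHS]/(zcoord_inv (zcoord _)) zcoord_uS zcoord_invM zcoord_inv_u1; case: j => [|j].
  by rewrite zcoord_inv_uS /= /fdb_x u1V_mull.
rewrite linearD linearZ /= (morph_exp zcoord_inv1 zcoord_invM) !zcoord_inv_uS /=.
by rewrite /fdb_z subrK /fdb_x u1V_mull.
Qed.

Lemma zcoord_invK : cancel zcoord_inv zcoord.
Proof.
move=> h; apply: (alg_endo_id (L := zcoord \o zcoord_inv)) => [|f g|||j].
- by rewrite /= zcoord_inv1 zcoord1.
- exact: etrans (congr1 zcoord (zcoord_invM f g)) (zcoordM _ _).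
- by rewrite -[LHS]/(zcoord (zcoord_inv _)) zcoord_inv_u1 zcoord_u1.
- by rewrite -[LHS]/(zcoord (zcoord_inv _)) zcoord_inv_v zcoord_v.
have cx1 : zcoord (fdb_x K 1) = u 2.
  by rewrite /fdb_x zcoordM zcoord_v zcoord_uS /= u1V_mulr.
rewrite -[LHS]/(zcoord (zcoord_inv _)) zcoord_inv_uS; case: j => [//|j].
have cE f g a : zcoord (f - a *: g) = zcoord f - a *: zcoord g.
  exact: etrans (linearB zcoord f (a *: g)) (congr1 (fun x => zcoord f - x) (linearZZ zcoord a g)).
have cx : zcoord (fdb_x K j.+2) = u j.+3 + zcoef j.+2 *: u 2 ^+ j.+2.
  by rewrite /fdb_x zcoordM zcoord_v zcoord_uS /zvar_expansion u1V_mulr.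
rewrite -[zvar _]/(fdb_x K j.+2 - zcoef j.+2 *: fdb_x K 1 ^+ j.+2).
have cx1E : zcoord (fdb_x K 1 ^+ j.+2) = u 2 ^+ j.+2.
  by apply: etrans (morph_exp zcoord1 zcoordM _ _) _; rewrite cx1.
apply: etrans (cE _ _ _) _.
by apply: etrans (congr2 (fun a b => a - zcoef j.+2 *: b) cx cx1E) _; apply: addrK.
Qed.

Definition fdb_filt (n : nat) (h : H) : Prop := deg_lt mono_deg n (zcoord h).

Definition zcoord_coef (m : fdb_monom) (f : H) : K^o := (zcoord f)@_m.

Lemma zcoord_coef_linear m : linear (zcoord_coef m).
Proof. by move=> a f g; rewrite /zcoord_coef linearP mcoeffD mcoeffZ. Qed.
HB.instance Definition _ m := GRing.isLinear.Build K H K^o *:%R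
  (zcoord_coef m) (zcoord_coef_linear m).

(** The component at the monomial [m] of the left factor. *)
Definition slice (m : fdb_monom) (t : H2) : H := contr_l (zcoord_coef m) t.

Lemma slice_is_linear m : linear (slice m).
Proof. by move=> a s t; rewrite /slice linearP. Qed.
HB.instance Definition _ m := GRing.isLinear.Build K H2 H *:%R
  (slice m) (slice_is_linear m).

Lemma slice_tens m f g : slice m (tens f g) = (zcoord f)@_m *: g.
Proof. exact: (contr_l_tens (zcoord_coef m)). Qed.

Lemma slice_tmap m (F : {linear H -> H}) (t : H2) :
  slice m (tmap idfun F t) = F (slice m t).
Proof.
apply: (@tens_ext K _ _ _ (slice m \o tmap idfun F) (F \o slice m) _ t) => f g.
have e1 : slice m (tmap idfun F (tens f g)) = (zcoord f)@_m *: F g.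
  exact: etrans (congr1 (slice m) (tmap_tens idfun F f g)) (slice_tens m f (F g)).
have e2 : F (slice m (tens f g)) = (zcoord f)@_m *: F g.
  exact: etrans (congr1 F (slice_tens m f g)) (linearZ _ _).
exact: etrans e1 (esym e2).
Qed.

Lemma slice_counit m (t : H2) : (zcoord (contr_r eps t))@_m = eps (slice m t).
Proof.
apply: (@tens_ext K _ _ _ (zcoord_coef m \o contr_r eps) (eps \o slice m) _ t) => f g.
have e1 : zcoord_coef m (contr_r eps (tens f g)) = eps g * zcoord_coef m f.
  exact: etrans (congr1 (zcoord_coef m) (contr_r_tens eps f g)) (linearZ _ _).
have e2 : eps (slice m (tens f g)) = zcoord_coef m f * eps g.
  exact: etrans (congr1 eps (slice_tens m f g)) (linearZ _ _).
apply: etrans e1 _; apply: etrans (mulrC _ _) (esym e2).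
Qed.

Lemma fdb_filt_spec :
  [/\ forall j n h, fdb_filt n h -> fdb_filt (n - var_deg j) (vfield j h),
      forall n h, fdb_filt n (vfield 0 h) -> fdb_filt n (vfield 1 h) -> fdb_filt n.+1 h,
      forall n h m, fdb_filt n h -> fdb_filt (n - mono_deg m) (slice m (Delta h)),
      forall n h, (forall m, (0 < mono_deg m)%N -> fdb_filt n (slice m (Delta h))) ->
        fdb_filt n.+1 h
    & forall t, exists d : {fset fdb_monom},
        t = \sum_(m <- d) tens (zcoord_inv (basis K m)) (slice m t)].
Proof.
have [Deps DM Du DD Dbr] := vfield_spec K0.
apply: (@filt_spec K H u v K0 (fdb_u1V K) zcoord zcoord_inv zcoordK zcoord_invK zcoordM
  zcoord_invM zcoord1 zcoord_inv_u1 zcoord_inv_v zcoord_inv_uS (@vfield K) DM Du (@vfield_v K)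
  Dbr H2 (@tens K fdb_monom fdb_monom) (@tens_linl K _ _) (@tens_linr K _ _)
  (fun a b c d => @tensM K fdb_monom fdb_monom a c b d) _ (@H2_ind K)
  Delta (@fdb_comul1 K) (@fdb_comulM K) (@fdb_comulE K)
  (@fdb_comul_u1_inv K) slice slice_tens _ eps _).
- by rewrite [LHS]tensUU.
- move=> m j h.
  exact: etrans (congr1 (slice m) (DD j h)) (slice_tmap m (vfield j) _).
move=> m h.
exact: etrans (congr1 (zcoord_coef m) (esym (Deps h))) (slice_counit m _).
Qed.

End AdaptedCoordinates.

(** * Tensor subspaces and the opposite coalgebra *)

Section TensSubspace.
Variables (K : fieldType) (I J : choiceType).
Implicit Types (D : {malg K[I]} -> Prop) (E : {malg K[J]} -> Prop).

Lemma tens_subspaceS D D' E E' t :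
  (forall f, D f -> D' f) -> (forall g, E g -> E' g) ->
  tens_subspace D E t -> tens_subspace D' E' t.
Proof.
move=> DD' EE'; apply: span_ind => [|a s s' Ds Ds'|_ [f [g [Df Eg ->]]]].
- exact: span0.
- exact: span_lin.
by apply: span_in; exists f, g; split; [apply: DD'|apply: EE'|].
Qed.

Lemma tens_subspace_in D E f g : D f -> E g -> tens_subspace D E (tens f g).
Proof. by move=> Df Eg; apply: span_in; exists f, g. Qed.

Lemma tens_subspace_sum D E (T : eqType) (r : seq T) (P : pred T) F :
  (forall i, P i -> tens_subspace D E (F i)) ->
  tens_subspace D E (\sum_(i <- r | P i) F i).
Proof.
move=> DF; elim/big_ind: _ => // [|s t Ds Dt]; first exact: span0.
by rewrite -[s]scale1r; apply: span_lin.
Qed.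

Lemma tens_swap_tens (f : {malg K[I]}) (g : {malg K[J]}) :
  tens_swap (tens f g) = tens g f.
Proof.
apply: (bilin_ext (B := fun f g => tens_swap (tens f g)) (B' := fun f g => tens g f))
  => [h a s t|h a s t|h a s t|h a s t|i j].
- by rewrite tens_linl linearP.
- by rewrite !linearP.
- by rewrite !linearP.
- by rewrite tens_linl.
by rewrite tensUU /tens_swap linext_basis tensUU.
Qed.

End TensSubspace.

Section Swap.
Variables (K : fieldType).

Lemma tens_swapK (I J : choiceType) (t : {malg K[(I * J)%type]}) :
  tens_swap (tens_swap t) = t.
Proof.
apply: (@tens_ext K _ _ _ (@tens_swap K J I \o @tens_swap K I J) idfun) => f g /=.
by rewrite !tens_swap_tens.
Qed.

Lemma tens_subspace_swap (I J : choiceType) (D : {malg K[I]} -> Prop)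
    (E : {malg K[J]} -> Prop) t :
  tens_subspace D E t -> tens_subspace E D (tens_swap t).
Proof.
apply: (span_ind (P := fun t => tens_subspace E D (tens_swap t)))
  => [|a s s' Ds Ds'|_ [f [g [Df Eg ->]]]].
- by rewrite linear0; apply: span0.
- by rewrite linearP; exact: (span_lin a Ds Ds').
by rewrite tens_swap_tens; exact: (tens_subspace_in Eg Df).
Qed.

Lemma subcoalgebra_cop (I : choiceType) (C : coalgebra_data K I) D :
  subcoalgebra (cop C) D <-> subcoalgebra C D.
Proof.
split=> -[Dsub DC]; split=> // h /DC; last exact: tens_subspace_swap.
by move/tens_subspace_swap; rewrite tens_swapK.
Qed.

Lemma simple_cop (I : choiceType) (C : coalgebra_data K I) D :
  simple_subcoalgebra (cop C) D <-> simple_subcoalgebra C D.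
Proof.
by split=> -[Dsub Dn0 Dmin]; split=> //; [apply/subcoalgebra_cop|
  |apply/subcoalgebra_cop|] => // E /subcoalgebra_cop; apply: Dmin.
Qed.

Lemma coradical_cop (I : choiceType) (C : coalgebra_data K I) h :
  coradical (cop C) h <-> coradical C h.
Proof.
by split; apply: span_ind => [|a s t|g [D /simple_cop Ds Dg]];
  [exact: span0|exact: span_lin|apply: span_in; exists D
  |exact: span0|exact: span_lin|apply: span_in; exists D].
Qed.

End Swap.

(** * The spaces F_n as a degree filtration *)

Lemma prod_nat_shift (R : comNzRingType) (G G' : nat -> R) N :
  (forall i, G' i.+2 = G i.+1) ->
  \prod_(0 <= j < N.+1) G j = (\prod_(2 <= i < N.+2) G' i) * G 0%N.
Proof.
move=> GG'; rewrite big_ltn // mulrC; congr (_ * _).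
by rewrite [RHS]big_add1 [LHS]big_add1 [RHS]big_add1; apply: eq_bigr.
Qed.

Section DegreeFiltration.
Variable K : fieldType.
Notation H := (HFdB K).
Notation u := (fdb_u K).
Notation v := (fdb_u1_inv K).
Notation Delta := (@fdb_comul K).
Notation X k := (basis K ((k, 0) : fdb_monom) : H).
Notation ffilt := (@fdb_filt K).

Lemma laurent_basis k : laurent_pow (u 1) v k = X k.
Proof.
have E k' n : (basis K ((k', 0) : fdb_monom) : H) ^+ n
    = basis K ((k' *+ n, 0) : fdb_monom).
  elim: n => [|n IH]; first by rewrite expr0 mulr0n.
  rewrite exprS IH ma_basisM mulrS; congr (basis K (_, _)); exact: addr0.
case: k => n; rewrite /laurent_pow [LHS]E; congr (basis K (_, _)).
  by rewrite -[1 *+ n]/(n%:R) natz.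
by rewrite NegzE mulNrn -[1 *+ _]/(n.+1%:R) natz.
Qed.

Lemma laurent_succ k : X (k + 1) = u 1 * X k.
Proof. by rewrite [RHS]ma_basisM; congr (basis K (_, _)); rewrite ?add0r // addrC. Qed.

Lemma laurent_pred k : X (k - 1) = v * X k.
Proof. by rewrite [RHS]ma_basisM; congr (basis K (_, _)); rewrite ?add0r // addrC. Qed.

Lemma zcoord_laurent k : zcoord (X k) = X k.
Proof.
apply: etrans (fdb_evalU _ _ _ _) _.
by rewrite -[(k, 0).2]/(mone : {cmonom nat}) mdom1 big_seq_fset0 mulr1 laurent_basis.
Qed.

Lemma zcoord_inv_laurent k : zcoord_inv (X k) = X k.
Proof. by rewrite -{1}zcoord_laurent zcoordK. Qed.

Lemma comul_laurent k : Delta (X k) = tens (X k) (X k).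
Proof.
elim/int_rect: k => [|n IH|n IH].
- by apply: etrans (@fdb_comul1 K) _; rewrite tensUU.
- rewrite -addn1 PoszD laurent_succ; apply: etrans (@fdb_comulM K _ _) _.
  rewrite IH (_ : Delta (u 1) = tens (u 1) (u 1)); last first.
    exact: etrans (fdb_eval_u1 _ _ _) (fdb_comul_u1E K).
  exact: esym (@tensM K fdb_monom fdb_monom _ _ _ _).
- rewrite -addn1 PoszD opprD laurent_pred; apply: etrans (@fdb_comulM K _ _) _.
  rewrite IH fdb_comul_u1_inv.
  exact: esym (@tensM K fdb_monom fdb_monom _ _ _ _).
Qed.

Lemma fdb_filt_lin n a (f g : H) : ffilt n f -> ffilt n g -> ffilt n (a *: f + g).
Proof. by rewrite /fdb_filt linearP; apply: deg_lt_lin. Qed.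

Lemma fdb_filt0 n : ffilt n 0.
Proof. by rewrite /fdb_filt linear0; apply: deg_lt0. Qed.

Lemma fdb_filtW m n (f : H) : (m <= n)%N -> ffilt m f -> ffilt n f.
Proof. by move=> mn mf; apply: (deg_ltW mn mf). Qed.

Lemma fdb_filtM m n (f g : H) : ffilt m.+1 f -> ffilt n g -> ffilt (m + n) (f * g).
Proof.
rewrite /fdb_filt zcoordM; apply: deg_ltM; exact: mono_degD.
Qed.

Lemma fdb_filt_1 : ffilt 1 1.
Proof. by rewrite /fdb_filt zcoord1; apply: deg_lt_basis; rewrite mono_deg_laurent. Qed.

Lemma fdb_filt_exp m (f : H) n : ffilt m.+1 f -> ffilt (m * n).+1 (f ^+ n).
Proof.
move=> mf; elim: n => [|n IH]; first by rewrite muln0 expr0; apply: fdb_filt_1.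
by rewrite exprS mulnS -addnS; apply: fdb_filtM.
Qed.

Lemma fdb_filt_basis p : ffilt (mono_deg p).+1 (zcoord_inv (basis K p)).
Proof. by rewrite /fdb_filt zcoord_invK; apply: deg_lt_basis. Qed.

Lemma fdb_filt_laurent k : ffilt 1 (X k).
Proof. by rewrite -zcoord_inv_laurent -(mono_deg_laurent k); apply: fdb_filt_basis. Qed.

Lemma fdb_filt_gen i : ffilt (var_deg i).+1 (zvar K i).
Proof. by rewrite -zcoord_inv_uS -(mono_deg_var 0 i); apply: fdb_filt_basis. Qed.

Lemma fdb_filt_ind n (P : H -> Prop) : P 0 ->
  (forall a f g, P f -> P g -> P (a *: f + g)) ->
  (forall p, (mono_deg p < n)%N -> P (zcoord_inv (basis K p))) ->
  forall f, ffilt n f -> P f.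
Proof.
move=> P0 PD PX f nf; rewrite -[f]zcoordK -[zcoord f]linext_id linext_comp /linext big_seq.
elim/big_ind: _ => // [g h Pg Ph|p]; first by rewrite -[g]scale1r; apply: PD.
by rewrite -mcoeff_neq0 => /nf pn; rewrite -[_ *: _]addr0; apply: PD => //; apply: PX.
Qed.

Lemma fdb_filt1_ind (P : H -> Prop) : P 0 ->
  (forall a f g, P f -> P g -> P (a *: f + g)) -> (forall k, P (X k)) ->
  forall f, ffilt 1 f -> P f.
Proof.
move=> P0 PD PX; apply: fdb_filt_ind => // -[k m].
rewrite ltnS leqn0 => /eqP/mono_deg_eq0 /= ->; rewrite zcoord_inv_laurent; exact: PX.
Qed.

Lemma fdb_filt_ex (h : H) : exists n, ffilt n h.
Proof.
exists (\max_(p <- msupp (zcoord h)) mono_deg p).+1 => p.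
by rewrite mcoeff_neq0 => ph; rewrite ltnS; apply: leq_bigmax_seq.
Qed.

Lemma big_finsupp (R : Type) (idx : R) (op : Monoid.com_law idx)
    (m : {cmonom nat}) (N : nat) (F : nat -> nat -> R) :
  (forall j, F j 0%N = idx) -> (forall j, (N <= j)%N -> m j = 0%N) ->
  \big[op/idx]_(j <- finsupp m) F j (m j) = \big[op/idx]_(0 <= j < N) F j (m j).
Proof.
move=> F0 mN; rewrite [RHS](bigID (fun j => j \in finsupp m)) /=.
rewrite [T in op _ T]big1 ?Monoid.mulm1 => [|j]; last first.
  by rewrite -cmE_neq0 negbK => /eqP ->.
rewrite -[in RHS]big_filter; apply: perm_big; apply: uniq_perm.
- exact: fset_uniq.
- by rewrite filter_uniq // iota_uniq.
move=> j; rewrite mem_filter mem_index_iota /=; case jm: (j \in finsupp m) => //=.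
by apply/esym; rewrite ltnNge; apply/negP => /mN; apply/eqP; rewrite cmE_neq0.
Qed.

Lemma fdb_filt_prod (r : seq nat) (P : pred nat) (d : nat -> nat) (F : nat -> H) :
  (forall i, P i -> ffilt (d i).+1 (F i)) ->
  ffilt (\sum_(i <- r | P i) d i)%N.+1 (\prod_(i <- r | P i) F i).
Proof.
move=> dF; elim/big_rec2: _ => [|i a b Pi IH]; first exact: fdb_filt_1.
by apply: (fdb_filtW _ (fdb_filtM (dF i Pi) IH)); rewrite addnS.
Qed.

Lemma fdb_F_filt n f : fdb_F n f -> ffilt n.+1 f.
Proof.
apply: (span_ind (P := ffilt n.+1)) => [||_ [N [s [le_n ->]]]].
- exact: fdb_filt0.
- by move=> a f1 f2; apply: fdb_filt_lin.
apply: (@fdb_filtW (_ + _).+1 n.+1 _ le_n); rewrite -addnS; apply: fdb_filtM; last first.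
  by rewrite -{1}[s 1%N]mul1n; apply: fdb_filt_exp; apply: (@fdb_filt_gen 0).
rewrite !big_nat; apply: fdb_filt_prod => -[|[|i]] // _.
by apply: fdb_filt_exp; rewrite subn1; apply: (@fdb_filt_gen i.+1).
Qed.

Lemma laurent_x_fdb_filt g : fdb_laurent_x g -> ffilt 1 g.
Proof.
apply: (span_ind (P := ffilt 1)) => [||_ [k ->]].
- exact: fdb_filt0.
- by move=> a f1 f2; apply: fdb_filt_lin.
by rewrite laurent_basis; apply: fdb_filt_laurent.
Qed.

Lemma calF_fdb_filt n h : fdb_calF n h -> ffilt n.+1 h.
Proof.
apply: (span_ind (P := ffilt n.+1)) => [||_ [f [g [Ff Lg ->]]]].
- exact: fdb_filt0.
- by move=> a f1 f2; apply: fdb_filt_lin.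
rewrite -addn1; apply: fdb_filtM; first exact: fdb_F_filt.
exact: laurent_x_fdb_filt.
Qed.

Lemma fdb_filt_calF n h : ffilt n.+1 h -> fdb_calF n h.
Proof.
apply: (fdb_filt_ind (P := fdb_calF (K := K) n)) => [||p pn].
- exact: span0.
- by move=> a f g; apply: span_lin.
pose m := p.2; have [N mN] : exists N, forall j, (N.+1 <= j)%N -> m j = 0%N.
  exists (\max_(j <- finsupp m) j) => j Nj; apply/eqP; rewrite cmE_eq0.
  apply/negP => jm; move: Nj; rewrite ltnNge; case/negP.
  by apply: (@leq_bigmax_seq _ _ predT id).
apply: span_in; exists ((\prod_(2 <= i < N.+2) fdb_z K i ^+ m i.-1) * fdb_x K 1 ^+ m 0%N).
exists (X p.1); split; last 1 first.
- apply: etrans (fdb_evalU _ _ _ _) _; rewrite laurent_basis mulrC; congr (_ * _).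
  rewrite (@big_finsupp _ _ _ _ N.+1 (fun j k => zvar K j ^+ k)) //.
  exact: (prod_nat_shift (G := fun j => zvar K j ^+ m j)).
- apply: span_in; exists N.+2, (fun i => m i.-1); split=> //.
  have : (mono_deg p <= n)%N by [].
  apply: leq_trans; rewrite /mono_deg.
  rewrite (@big_finsupp _ _ _ _ N.+1 (fun j k => var_deg j * k)%N) // => [|j]; last exact: muln0.
  rewrite [T in (_ <= T)%N]big_ltn // addnC leq_add ?mul1n //.
  rewrite big_add1 /= !big_nat leq_sum // => i /andP[i0 _].
  by rewrite subSS subn0 leq_mul // /var_deg; lia.
by apply: span_in; exists p.1; rewrite laurent_basis.
Qed.

End DegreeFiltration.

(** * The coradical and the two wedges *)

Section Coradical.
Variable K : fieldType.
Hypothesis K0 : [pchar K] =i pred0.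
Notation H := (HFdB K).
Notation H2 := (HFdB2 K).
Notation Delta := (@fdb_comul K).
Notation C := (fdb_coalgebra K).
Notation X k := (basis K ((k, 0) : fdb_monom) : H).
Notation ffilt := (@fdb_filt K).

Lemma contr_r_in (D : H -> Prop) (E : H -> Prop) (phi : {linear H -> K^o}) (t : H2) :
  D 0 -> (forall a f g, D f -> D g -> D (a *: f + g)) ->
  tens_subspace D E t -> D (contr_r phi t).
Proof.
move=> D0 Dl; apply: (span_ind (P := fun t => D (contr_r phi t))).
- by rewrite linear0.
- move=> a s s' Ds Ds'.
  exact: (eq_ind_r D (Dl a _ _ Ds Ds') (linearP (contr_r phi) a s s')).
move=> _ [f [g [Df _ ->]]]; rewrite (contr_r_tens phi f g) -[_ *: _]addr0.
exact: Dl.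
Qed.

Lemma vfield_in D j h : subcoalgebra C D -> D h -> D (vfield j h).
Proof. by move=> [[D0 Dl] DC] /DC; apply: contr_r_in. Qed.

Lemma slice_in (D E : H -> Prop) m (t : H2) :
  E 0 -> (forall a f g, E f -> E g -> E (a *: f + g)) ->
  tens_subspace D E t -> E (slice m t).
Proof.
move=> E0 El; apply: (span_ind (P := fun t => E (slice m t))).
- by rewrite (linear0 (slice m)).
- move=> a s s' Ds Ds'.
  exact: (eq_ind_r E (El a _ _ Ds Ds') (linearP (slice m) a s s')).
move=> _ [f [g [_ Eg ->]]]; rewrite (slice_tens m f g) -[_ *: _]addr0.
exact: El.
Qed.

Lemma fdb_filt_eq0 h : ffilt 0 h -> h = 0.
Proof. by move/deg_lt0P => h0; rewrite -[h]zcoordK h0 linear0. Qed.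

(** Differentiate [h] as long as [vfield 0] or [vfield 1] does not kill it; the degree
drops each time, and an element killed by both has degree 0. *)
Lemma subcoalgebra_meets_F0 D h : subcoalgebra C D -> D h -> h != 0 ->
  exists2 g, D g /\ g != 0 & ffilt 1 g.
Proof.
move=> DC; have [n] := fdb_filt_ex h; have [FD F2 _ _ _] := fdb_filt_spec K0.
elim: n h => [|n IH] h nh Dh h0; first by rewrite (fdb_filt_eq0 nh) eqxx in h0.
have [v0|] := eqVneq (vfield 0 h) 0; last first.
  by apply: IH (vfield_in 0 DC Dh); have := FD 0%N _ _ nh; rewrite /var_deg subSS subn0.
have [v1|] := eqVneq (vfield 1 h) 0; last first.
  by apply: IH (vfield_in 1 DC Dh); have := FD 1%N _ _ nh; rewrite /var_deg subSS subn0.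
exists h => //; apply: F2; first by rewrite v0; apply: fdb_filt0.
by rewrite v1; apply: fdb_filt0.
Qed.

Definition laurent_line k (h : H) : Prop := exists a, h = a *: X k.

Lemma laurent_line_subcoalgebra k : subcoalgebra C (laurent_line k).
Proof.
split.
  split; first by exists 0; rewrite scale0r.
  by move=> a _ _ [b ->] [c ->]; exists (a * b + c); rewrite scalerDl scalerA.
move=> _ [a ->]; have -> : comul C (a *: X k) = a *: tens (X k) (X k).
  have e : comul C (X k) = tens (X k) (X k) := comul_laurent K k.
  by rewrite -e; apply: linearZZ.
rewrite -[_ *: _]addr0; apply: span_lin; last exact: span0.
by apply: tens_subspace_in; exists 1; rewrite scale1r.
Qed.

Lemma laurent_neq0 k : X k != 0.
Proof.
apply/eqP => /(congr1 (mcoeff ((k, 0) : fdb_monom))).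
by rewrite mcoeff_basis eqxx mcoeff0; apply/eqP; rewrite oner_eq0.
Qed.

Lemma laurent_line_simple k : simple_subcoalgebra C (laurent_line k).
Proof.
split; first exact: laurent_line_subcoalgebra.
  by exists (X k); [exists 1; rewrite scale1r|apply: laurent_neq0].
move=> E [[E0 El] _] EX; case: (classic (E (X k))) => [EXk|nEXk]; [right|left].
  by move=> _ [a ->]; rewrite -[_ *: _]addr0; apply: El.
move=> h Eh; have [a hE] := EX h Eh; have [a0|a0] := eqVneq a 0.
  by rewrite hE a0 scale0r.
case: nEXk; have -> : X k = a^-1 *: h + 0 by rewrite hE scalerA mulVf // scale1r addr0.
exact: El.
Qed.

Lemma slice_laurent k g : ffilt 1 g ->
  slice (k, 0) (Delta g) = (zcoord g)@_(k, 0) *: X k.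
Proof.
apply: (fdb_filt1_ind (P := fun g => slice (k, 0) (Delta g) = (zcoord g)@_(k, 0) *: X k)).
- by rewrite !linear0 mcoeff0 scale0r.
- move=> a f g' Hf Hg.
  apply: etrans (congr1 (slice (k, 0)) (linearP Delta a f g')) _.
  apply: etrans (linearP (slice (k, 0)) a (Delta f) (Delta g')) _.
  apply: etrans (congr2 (fun x y : H => a *: x + y) Hf Hg) _.
  by rewrite (linearP (@zcoord K)) mcoeffD mcoeffZ scalerDl scalerA.
move=> l; rewrite (comul_laurent K l).
apply: etrans (slice_tens _ _ _) _; rewrite zcoord_laurent mcoeff_basis.
by case: eqP => [[->]|]; rewrite ?scale0r.
Qed.

(** A simple subcoalgebra contains a nonzero Laurent polynomial in u_1, hence by
slicing its coproduct a power of u_1, whose line is a subcoalgebra. *)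
Lemma coradical_fdb h : coradical C h <-> ffilt 1 h.
Proof.
split; last first.
  apply: fdb_filt1_ind => [||k]; [exact: span0|by move=> *; apply: span_lin|].
  apply: span_in; exists (laurent_line k); first exact: laurent_line_simple.
  by exists 1; rewrite scale1r.
apply: (span_ind (P := ffilt 1)) => [||g [D [DC [g0 Dg0 g0n0] Dmin] Dg]].
- exact: fdb_filt0.
- by move=> *; apply: fdb_filt_lin.
have [f [Df f0] f1] := subcoalgebra_meets_F0 DC Dg0 g0n0.
have [p fp] : exists p, (zcoord f)@_p != 0.
  case: (classic (exists p, (zcoord f)@_p != 0)) => // nE; case/eqP: f0.
  rewrite -[f]zcoordK (_ : zcoord f = 0) ?linear0 //; apply/malgP => p.
  by rewrite mcoeff0; apply/eqP; apply: contraT => fp; case: nE; exists p.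
have [k pE] : exists k, p = (k, 0).
  have := f1 p fp; rewrite ltnS leqn0 => /eqP/mono_deg_eq0 p2.
  by exists p.1; rewrite -p2; case: (p).
rewrite {p}pE in fp; have [[D0 Dl] DD] := DC.
have DX : D (X k).
  have := slice_in (k, 0) D0 Dl (DD f Df); rewrite (slice_laurent k f1).
  move=> Da; have -> : X k = ((zcoord f)@_(k, 0))^-1 *: ((zcoord f)@_(k, 0) *: X k) + 0.
    by rewrite scalerA mulVf // scale1r addr0.
  by apply: Dl.
have [] := Dmin (laurent_line k) (laurent_line_subcoalgebra k).
- by move=> _ [a ->]; rewrite -[_ *: _]addr0; apply: Dl.
- move=> /(_ (X k)) X0; case/eqP: (laurent_neq0 k).
  by apply: X0; exists 1; rewrite scale1r.
move=> /(_ g Dg) [a ->]; rewrite -[_ *: _]addr0; apply: fdb_filt_lin; last exact: fdb_filt0.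
exact: fdb_filt_laurent.
Qed.

Lemma tangent_filt1 j g : ffilt 1 g -> tangent j g = 0.
Proof.
apply: (fdb_filt1_ind (P := fun g => tangent j g = 0)) => [|a f f' Hf Hf'|k].
- by rewrite linear0.
- by rewrite linearP /= Hf Hf' scaler0 addr0.
exact: tangent_laurent.
Qed.

(** From left to right, the terms of [Delta h] are split by the degree of the left
factor; from right to left, contraction with the tangent vectors kills the second
summand and bounds the degrees of [vfield 0 h] and [vfield 1 h]. *)
Lemma wedge_r n h :
  ffilt n.+2 h <-> sum_subspace (tens_subspace (ffilt n.+1) (fun=> True))
                                (tens_subspace (fun=> True) (ffilt 1)) (Delta h).
Proof.
have [FD F2 Fsl _ Fdec] := fdb_filt_spec K0; split.
  move=> nh; have [d dE] := Fdec (Delta h).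
  rewrite (bigID (fun m => (mono_deg m <= n)%N)) /= in dE.
  exists (\sum_(m <- d | (mono_deg m <= n)%N)
            tens (zcoord_inv (basis K m)) (slice m (Delta h))).
  exists (\sum_(m <- d | ~~ (mono_deg m <= n)%N)
            tens (zcoord_inv (basis K m)) (slice m (Delta h))).
  split; last exact: dE.
    apply: tens_subspace_sum => m mn; apply: tens_subspace_in; last exact: I.
    by apply: (fdb_filtW _ (@fdb_filt_basis K m)).
  apply: tens_subspace_sum => m mn; apply: tens_subspace_in; first exact: I.
  by apply: (fdb_filtW _ (Fsl _ _ m nh)); lia.
move=> [s [t [sD tD E]]].
have Dn j : ffilt n.+1 (vfield j h).
  pose cr := @contr_r K fdb_monom fdb_monom (tangent j).
  have e : vfield j h = cr s + cr t.
    by apply: etrans (congr1 cr E) _; apply: linearD.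
  have t0 : cr t = 0.
    move: t tD {E e}; apply: (span_ind (P := fun t => cr t = 0)).
    - exact: linear0.
    - by move=> a t t' Ht Ht'; rewrite /cr linearP -/cr /= [contr_r _ t]Ht
        [contr_r _ t']Ht' scaler0 addr0.
    move=> _ [f [g [_ g1 ->]]]; apply: etrans (contr_r_tens (tangent j) f g) _.
    by apply: etrans (congr1 (fun c : K => c *: f) (tangent_filt1 j g1)) _; apply: scale0r.
  rewrite e t0 addr0; apply: (contr_r_in _ _ _ sD); first exact: fdb_filt0.
  by move=> *; apply: fdb_filt_lin.
by apply: F2.
Qed.

(** In terms of [Delta h], membership in the wedge says that the components of
[Delta h] at monomials of positive degree have degree at most [n]. *)
Lemma wedge_l n h :
  ffilt n.+2 h <-> sum_subspace (tens_subspace (ffilt n.+1) (fun=> True))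
                     (tens_subspace (fun=> True) (ffilt 1)) (comul (cop C) h).
Proof.
have [FD F2 Fsl Fof Fdec] := fdb_filt_spec K0; split.
  move=> nh; have [d dE] := Fdec (Delta h).
  rewrite (bigID (fun m => (0 < mono_deg m)%N)) /= in dE.
  exists (tens_swap (\sum_(m <- d | (0 < mono_deg m)%N)
            tens (zcoord_inv (basis K m)) (slice m (Delta h)))).
  exists (tens_swap (\sum_(m <- d | ~~ (0 < mono_deg m)%N)
            tens (zcoord_inv (basis K m)) (slice m (Delta h)))).
  split; last by rewrite -linearD -dE.
    apply: tens_subspace_swap; apply: tens_subspace_sum => m mn.
    apply: tens_subspace_in; first exact: I.
    by apply: (fdb_filtW _ (Fsl _ _ m nh)); lia.
  apply: tens_subspace_swap; apply: tens_subspace_sum => m mn.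
  apply: tens_subspace_in; last exact: I.
  by apply: (fdb_filtW _ (@fdb_filt_basis K m)); rewrite -eqn0Ngt in mn; rewrite (eqP mn).
move=> [s [t [sD tD E]]]; apply: Fof => m m0.
have e : Delta h = tens_swap s + tens_swap t.
  apply: etrans (esym (tens_swapK _)) _.
  by apply: etrans (congr1 (@tens_swap K _ _) E) _; apply: linearD.
have t0 : slice m (tens_swap t) = 0.
  move/tens_subspace_swap: tD; move: (tens_swap t) {E e} => {}t.
  apply: (span_ind (P := fun t => slice m t = 0)).
  - by rewrite (linear0 (slice m)).
  - by move=> a r r' Hr Hr'; rewrite (linearP (slice m)) /= Hr Hr' scaler0 addr0.
  move=> _ [f [g [f1 _ ->]]]; apply: etrans (slice_tens m f g) _.
  have [->|/f1] := eqVneq (zcoord f)@_m 0; first by rewrite scale0r.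
  by rewrite ltnNge m0.
have -> : slice m (Delta h) = slice m (tens_swap s).
  apply: etrans (congr1 (slice m) e) _.
  apply: etrans (linearD (slice m) _ _) _.
  exact: etrans (congr1 (+%R (slice m (tens_swap s))) t0) (addr0 _).
apply: (slice_in _ _ _ (tens_subspace_swap sD)); first exact: fdb_filt0.
by move=> *; apply: fdb_filt_lin.
Qed.

Lemma coradical_filtrationE (B : coalgebra_data K fdb_monom) :
  (forall h, coradical B h <-> ffilt 1 h) ->
  (forall n h, ffilt n.+2 h <-> sum_subspace (tens_subspace (ffilt n.+1) (fun=> True))
     (tens_subspace (fun=> True) (ffilt 1)) (comul B h)) ->
  is_coradical_filtration B (@fdb_calF K).
Proof.
move=> B0 BS n h.
have calE m g : fdb_calF m g <-> ffilt m.+1 g by split; [exact: calF_fdb_filt|exact: fdb_filt_calF].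
apply: iff_trans (calE n h) _; elim: n h => [|n IH] h.
  exact: iff_sym (B0 h).
apply: iff_trans (BS n h) _; split=> -[s [t [Ds Dt E]]]; exists s, t; split=> //.
- by apply: tens_subspaceS Ds => // f /IH.
- by apply: tens_subspaceS Dt => // f /B0.
- by apply: tens_subspaceS Ds => // f /IH.
- by apply: tens_subspaceS Dt => // f /B0.
Qed.

End Coradical.

Theorem corollary5p11 (K : fieldType) (charK0 : [pchar K]%R =i pred0) :
  is_coradical_filtration (cop (fdb_coalgebra K)) (@fdb_calF K) /\
  is_coradical_filtration (fdb_coalgebra K) (@fdb_calF K).
Proof.
split; apply: coradical_filtrationE.
- move=> h; apply: iff_trans (coradical_cop _ _) _; exact: coradical_fdb.
- exact: wedge_l.
- exact: coradical_fdb.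
- exact: wedge_r.
Qed.
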